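(* Let $M$ be a connected compact one-manifold, i.e. $M=[0,1]$ or $M=S^1$. Let $P_4$ be the path graph with vertex set $\{a,b,c,d\}$ and edge set $\{\{b,d\},\{d,a\},\{a,c\}\}$. Suppose there is an injective homomorphism $\phi\colon A(P_4)\to\mathrm{Diff}_+^{1+\mathrm{bv}}(M)$ such that $\mathrm{Fix}\,\phi(v)\neq\varnothing$ for each $v\in\{a,b,c,d\}$. Then there exist collections of infinitely many intervals $\{I_a^j : j\ge 1\}\subseteq\pi_0(\mathrm{supp}\,\phi(a))$ and $\{I_d^j : j\ge 1\}\subseteq\pi_0(\mathrm{supp}\,\phi(d))$ such that: (i) $I_v^j\neq I_v^k$ whenever $v\in\{a,d\}$ and $j\neq k$; (ii) for each $j$, $I_a^j\neq I_d^j$ and $\phi(cb)I_a^j\cap I_d^j\neq\varnothing$.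
   Context: $\mathrm{Diff}_+^{1+\mathrm{bv}}(M)$ denotes the group (under composition) of orientation-preserving $C^1$ diffeomorphisms $f$ of $M$ whose first derivative $f'$ has bounded total variation on $M$. $A(P_4)$ is the right-angled Artin group generated by $a,b,c,d$ with defining relations $[b,d]=[d,a]=[a,c]=1$ (adjacent vertices commute). For a homeomorphism $f$ of $M$, $\mathrm{Fix}\,f=\{x\in M: f(x)=x\}$ and $\mathrm{supp}\,f=M\setminus\mathrm{Fix}\,f$. $\pi_0(Y)$ denotes the set of connected components of $Y$. Thus $\phi(cb)=\phi(c)\circ\phi(b)$. *)

(* Defs.v *)
From HB Require Import structures.
From mathcomp Require Import all_boot all_order all_algebra.
From mathcomp Require Import all_classical all_reals all_analysis.

Set Implicit Arguments.
Unset Strict Implicit.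
Unset Printing Implicit Defensive.

Import Order.TTheory GRing.Theory Num.Theory.
Import numFieldNormedType.Exports.
Local Open Scope classical_set_scope.
Local Open Scope ring_scope.

(** * Right-angled Artin groups *)

Section Raag.
Variables (V : choiceType) (e : rel V).

(* [(v, true)] is the letter v and [(v, false)] is its formal inverse. *)
Definition word := seq (V * bool).

Definition word_inv (w : word) : word := rev [seq (l.1, ~~ l.2) | l <- w].

(* The congruence presenting the group: free cancellation, together with the
   commutation of adjacent vertices. *)
Inductive word_equiv : word -> word -> Prop :=
| We_refl w : word_equiv w w
| We_sym w1 w2 : word_equiv w1 w2 -> word_equiv w2 w1
| We_trans w1 w2 w3 : word_equiv w1 w2 -> word_equiv w2 w3 -> word_equiv w1 w3
| We_cat u1 u2 w1 w2 :
    word_equiv u1 u2 -> word_equiv w1 w2 -> word_equiv (u1 ++ w1) (u2 ++ w2)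
| We_cancel v s : word_equiv [:: (v, s); (v, ~~ s)] [::]
| We_comm u v :
    e u v -> word_equiv [:: (u, true); (v, true)] [:: (v, true); (u, true)].

Definition word_equivb (w1 w2 : word) : bool := `[< word_equiv w1 w2 >].

Lemma word_equivb_refl : reflexive word_equivb.
Proof. by move=> w; apply/asboolP; exact: We_refl. Qed.

Lemma word_equivb_sym : symmetric word_equivb.
Proof. by move=> w1 w2; apply/asboolP/asboolP => h; exact: We_sym. Qed.

Lemma word_equivb_trans : transitive word_equivb.
Proof.
by move=> w2 w1 w3 /asboolP h1 /asboolP h2; apply/asboolP; exact: We_trans h2.
Qed.

Canonical word_equivb_equiv :=
  EquivRel word_equivb word_equivb_refl word_equivb_sym word_equivb_trans.

Local Open Scope quotient_scope.

Definition raag : Type := {eq_quot word_equivb}.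

HB.instance Definition _ := Choice.on raag.
HB.instance Definition _ : EqQuotient word word_equivb raag :=
  EqQuotient.on raag.

Lemma raag_eqP (w1 w2 : word) :
  word_equiv w1 w2 <-> \pi_raag w1 = \pi_raag w2.
Proof.
split; first by move=> h; apply/eqP; rewrite piE; apply/asboolP.
by move/eqP; rewrite piE => /asboolP.
Qed.

Lemma raag_reprK (w : word) : word_equiv (repr (\pi_raag w)) w.
Proof. by apply/raag_eqP; rewrite reprK. Qed.

Lemma word_inv_cat (w1 w2 : word) :
  word_inv (w1 ++ w2) = word_inv w2 ++ word_inv w1.
Proof. by rewrite /word_inv map_cat rev_cat. Qed.

Lemma word_invK : involutive word_inv.
Proof.
move=> w; rewrite /word_inv map_rev revK -map_comp -[RHS]map_id.
by apply: eq_map => -[v s] /=; rewrite negbK.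
Qed.

Lemma word_mulV (w : word) : word_equiv (w ++ word_inv w) [::].
Proof.
elim: w => [|[v s] w IH]; first exact: We_refl.
have E : word_inv [:: (v, s)] = [:: (v, ~~ s)] by [].
rewrite -[(v, s) :: w]cat1s word_inv_cat.
rewrite E -catA (catA w); apply: We_trans (We_cancel v s).
apply: (We_cat (u2 := [:: (v, s)]) (w2 := [:: (v, ~~ s)])).
  exact: We_refl.
by apply: (We_cat (u2 := [::])) => //; exact: We_refl.
Qed.

Lemma word_mulVw (w : word) : word_equiv (word_inv w ++ w) [::].
Proof. by rewrite -{2}[w]word_invK; exact: word_mulV. Qed.

Definition raag_one : raag := \pi_raag [::].
Definition raag_inv (x : raag) : raag := \pi_raag (word_inv (repr x)).
Definition raag_mul (x y : raag) : raag := \pi_raag (repr x ++ repr y).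

Lemma raag_mulE (w1 w2 : word) :
  raag_mul (\pi_raag w1) (\pi_raag w2) = \pi_raag (w1 ++ w2).
Proof. by apply/raag_eqP; apply: We_cat; exact: raag_reprK. Qed.

Lemma raag_mulA : associative raag_mul.
Proof.
move=> x y z; apply/raag_eqP.
apply: (We_trans (w2 := repr x ++ repr y ++ repr z)).
  by apply: We_cat; [exact: We_refl | exact: raag_reprK].
by rewrite catA; apply: We_cat; [apply: We_sym; exact: raag_reprK | exact: We_refl].
Qed.

Lemma raag_mul1g : left_id raag_one raag_mul.
Proof.
move=> x; rewrite -[RHS]reprK; apply/raag_eqP.
apply: (We_cat (u2 := [::])); [exact: raag_reprK | exact: We_refl].
Qed.

Lemma raag_mulg1 : right_id raag_one raag_mul.
Proof.
move=> x; rewrite -[RHS]reprK; apply/raag_eqP.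
rewrite -[X in word_equiv _ X]cats0.
apply: We_cat; [exact: We_refl | exact: raag_reprK].
Qed.

Lemma raag_mulVg : left_inverse raag_one raag_inv raag_mul.
Proof.
move=> x; apply/raag_eqP; apply: We_trans (word_mulVw (repr x)).
by apply: We_cat; [exact: raag_reprK | exact: We_refl].
Qed.

Lemma raag_mulgV : right_inverse raag_one raag_inv raag_mul.
Proof.
move=> x; apply/raag_eqP; apply: We_trans (word_mulV (repr x)).
by apply: We_cat; [exact: We_refl | exact: raag_reprK].
Qed.

HB.instance Definition _ := isGroup.Build raag
  raag_mulA raag_mul1g raag_mulg1 raag_mulVg raag_mulgV.

Definition raag_gen (v : V) : raag := \pi_raag [:: (v, true)].

End Raag.

Arguments raag_gen {V} e v.

Inductive P4_vertex := va | vb | vc | vd.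

HB.instance Definition _ := gen_eqMixin P4_vertex.
HB.instance Definition _ := gen_choiceMixin P4_vertex.

Definition P4_edge : rel P4_vertex := fun u v =>
  match u, v with
  | vb, vd | vd, vb | vd, va | va, vd | va, vc | vc, va => true
  | _, _ => false
  end.

Definition A_P4 : groupType := raag P4_edge.

Definition A_P4_gen : P4_vertex -> A_P4 := raag_gen P4_edge.

(** * Compact connected one-manifolds *)

Definition unit_interval (R : realType) : topologicalType :=
  set_type `[0 : R, 1]%classic.

(* [Num.int_num_subdef] is the predicate underlying [Num.int], and the one
   that carries the closure properties. *)
Definition integers (R : realType) : zmodClosed R :=
  GRing.ZmodClosed.clone R (@Num.int_num_subdef R) _.

(* The circle R/Z, with the quotient topology. *)
Definition circle (R : realType) : topologicalType :=
  quotient_topology (Quotient.quot (integers R)).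

Definition circle_proj (R : realType) (t : R) : circle R :=
  \pi_(quotient_topology (Quotient.quot (integers R)))%qT t.

Inductive one_manifold := Closed_interval | Circle_S1.

Definition carrier (R : realType) (M : one_manifold) : topologicalType :=
  match M with
  | Closed_interval => unit_interval R
  | Circle_S1 => circle R
  end.

Section Derivative.
Variable R : realType.

(* One-sided at the endpoints, since the limit is taken inside [0,1]. *)
Definition interval_has_derivative
    (f : unit_interval R -> unit_interval R) (Df : unit_interval R -> R) :=
  forall x : unit_interval R,
    (fun y : unit_interval R =>
       (set_val (f y) - set_val (f x)) / (set_val y - set_val x)) @ x^' --> Df x.

(* The derivative of a circle map is that of a lift to R; it does not depend
   on the lift. *)
Definition circle_has_derivative
    (f : circle R -> circle R) (Df : circle R -> R) :=
  exists2 F : R -> R,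
    forall t : R, circle_proj (F t) = f (circle_proj t) &
    forall t : R, is_derive t 1 F (Df (circle_proj t)).

Definition has_derivative (M : one_manifold) :
    (carrier R M -> carrier R M) -> (carrier R M -> R) -> Prop :=
  match M with
  | Closed_interval => interval_has_derivative
  | Circle_S1 => circle_has_derivative
  end.

(* On [0,1] the extension by 0 outside the interval is immaterial, as only
   partitions of [0,1] are considered; on the circle the variation is that of
   the associated 1-periodic function over one period. *)
Definition finite_variation (M : one_manifold) : (carrier R M -> R) -> Prop :=
  match M with
  | Closed_interval => fun h : unit_interval R -> R =>
      bounded_variation 0 1 ('valL_ 0 h)
  | Circle_S1 => fun h : circle R -> R =>
      bounded_variation 0 1 (h \o @circle_proj R)
  end.

Definition C1 (M : one_manifold) (f : carrier R M -> carrier R M) : Prop :=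
  exists2 Df, has_derivative f Df & continuous Df.

Definition C1_diffeo (M : one_manifold) (f : carrier R M -> carrier R M) :
    Prop :=
  C1 f /\ exists g, [/\ cancel f g, cancel g f & C1 g].

(* The underlying set of Diff_+^{1+bv}(M). *)
Definition Diff1bv (M : one_manifold) : set (carrier R M -> carrier R M) :=
  [set f | C1_diffeo f /\
     exists Df, [/\ has_derivative f Df, forall x, 0 < Df x
                  & finite_variation Df]].

End Derivative.

(** * Fixed points, supports and components *)

Definition Fix (X : Type) (f : X -> X) : set X := [set x | f x = x].

Definition supp (X : Type) (f : X -> X) : set X := ~` Fix f.

Definition pi0 (X : topologicalType) (Y : set X) : set (set X) :=
  [set connected_component Y x | x in Y].

(* Main.v *)
Require Import Defs.
From mathcomp Require Import all_boot all_order all_algebra.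
From mathcomp Require Import fingroup perm cyclic.
From mathcomp Require Import ring lra zify.
From mathcomp Require Import all_classical all_reals all_analysis.

(** Make A(P4) act on the line: extend the action on [0,1] by the identity, or
    lift the one on the circle, taking for each generator the lift with fixed
    points.  Denjoy's distortion estimate gives Kopell's lemma, so the support
    intervals of two commuting generators are equal or disjoint; by Hoelder's
    theorem, a and b commute on every common support interval of a and d.

    Let u = (cb) a (cb)^-1 and w = [u, d].  If a group E has no fixed point in
    a compact set X, some h in E moves X off itself, even with h in the kernel
    of a given morphism to a finite group.  Hence an element f of E which is the
    identity near every fixed point of E commutes with a conjugate of f by an
    element prescribed modulo that kernel.  The morphism sending a, b, c, d to
    the transpositions (01), (12), (23), (34) prevents this for f = w and for
    f = a.

    If there is a global fixed point, taking E = A(P4) and f = w shows that w is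
    nontrivial arbitrarily close to some global fixed point z, on one side.
    The points responsible for it are moved by a, fixed by d, and sent by cb to
    points moved by d; between them and z there are fixed points of a and of d,
    so they lie in infinitely many distinct intervals.

    On a circle without global fixed point, let E be the stabilizer of an end
    point of a support interval of d.  It contains a and b.  A common fixed point
    of a and b is moved by c or d, and by Kopell's lemma a is the identity near
    it; so f = a gives a contradiction. *)

Set Implicit Arguments.
Unset Strict Implicit.
Unset Printing Implicit Defensive.

Import Order.TTheory GRing.Theory Num.Theory.
Import numFieldNormedType.Exports.
Local Open Scope classical_set_scope.
Local Open Scope ring_scope.

(** * Increasing actions on the line *)

(** Each element acts by an increasing bijection of the line, hence by a homeomorphism: continuity
    comes from monotonicity. *)
Record line_action (R : realType) (G : groupType) (psi : G -> R -> R) : Prop :=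
  LineAction {
    actM : forall g h x, psi (g * h)%g x = psi g (psi h x);
    act1 : forall x, psi 1%g x = x;
    act_homo : forall g x y, x < y -> psi g x < psi g y }.

Definition support_comp (R : realType) (G : Type) (psi : G -> R -> R)
    (g : G) (p q : R) : Prop :=
  [/\ p < q, psi g p = p, psi g q = q &
      forall x, p < x < q -> psi g x <> x].

(** Conjugation by x -> -x, which carries what is proved on the right of a point over to its
    left. *)
Definition mirror (R : realType) (G : Type) (psi : G -> R -> R) (g : G) (x : R) : R :=
  - psi g (- x).

Section LineAction.
Variables (R : realType) (G : groupType) (psi : G -> R -> R).
Hypothesis Apsi : line_action psi.

Lemma act_lt g : {mono psi g : x y / x < y}.
Proof. by apply: leW_mono; apply: le_mono => x y; exact: act_homo. Qed.

Lemma act_le g : {mono psi g : x y / x <= y}.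
Proof. by apply: le_mono => x y; exact: act_homo. Qed.

Lemma act_inj g : injective (psi g).
Proof. exact: inc_inj (act_le g). Qed.

Lemma actK g : cancel (psi g) (psi g^-1%g).
Proof. by move=> x; rewrite -(actM Apsi) mulVg (act1 Apsi). Qed.

Lemma actKV g : cancel (psi g^-1%g) (psi g).
Proof. by move=> x; rewrite -(actM Apsi) mulgV (act1 Apsi). Qed.

Lemma act_ltV g x y : (psi g^-1%g x < y) = (x < psi g y).
Proof. by rewrite -(act_lt g) actKV. Qed.

Lemma act_gtV g x y : (x < psi g^-1%g y) = (psi g x < y).
Proof. by rewrite -(act_lt g) actKV. Qed.

Lemma act_fixV g x : psi g x = x -> psi g^-1%g x = x.
Proof. by move=> e; rewrite -{1}e actK. Qed.

Lemma act_fixM g h x : psi g x = x -> psi h x = x -> psi (g * h)%g x = x.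
Proof. by move=> eg eh; rewrite (actM Apsi) eh eg. Qed.

Lemma act_comm g h x : commute g h -> psi g (psi h x) = psi h (psi g x).
Proof. by move=> c; rewrite -!(actM Apsi) c. Qed.

Lemma act_between g p q x : psi g p = p -> psi g q = q ->
  (p < psi g x < q) = (p < x < q).
Proof. by move=> ep eq; rewrite -{1}ep -{1}eq !act_lt. Qed.

Lemma actX_fix g x n : psi g x = x -> psi (g ^+ n)%g x = x.
Proof.
move=> e; elim: n => [|n IH]; first by rewrite expg0 (act1 Apsi).
by rewrite expgS; exact: act_fixM.
Qed.

Lemma act_mirror : line_action (mirror psi).
Proof.
rewrite /mirror; split=> [g h x|x|g x y xy]; rewrite ?opprK ?(actM Apsi) ?(act1 Apsi) ?opprK //.
by rewrite ltrN2 act_lt ltrN2.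
Qed.

(** If the orbit of P stayed below Q, its supremum s would lie in [P, Q] and satisfy g^-1 s < s; an
    orbit point beyond g^-1 s is then sent beyond s. *)
Lemma orbit_push g P Q : P <= Q ->
  (forall x, P <= x <= Q -> x < psi g x) -> exists n, Q < psi (g ^+ n)%g P.
Proof.
move=> PQ mv; apply: contrapT => /forallNP H.
have {}H n : psi (g ^+ n)%g P <= Q by rewrite leNgt; apply/negP/H.
pose S := range (fun n => psi (g ^+ n)%g P).
have S0 : S P by exists 0%N; rewrite // expg0 (act1 Apsi).
have SS : has_sup S by split; [exists P|exists Q => _ [n _ <-]].
have Ps : P <= sup S by apply: ub_le_sup => //; case: SS.
have sQ : sup S <= Q by apply: ge_sup; [exists P|move=> _ [n _ <-]].
have := mv (sup S); rewrite Ps sQ => /(_ isT) lts.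
have lt2 : psi g^-1%g (sup S) < sup S by rewrite act_ltV.
have [_ [n _ <-]] := sup_gt (proj1 SS) lt2.
rewrite act_ltV -(actM Apsi) -expgS ltNge => /negP; apply.
by apply: ub_le_sup; [case: SS|exists n.+1].
Qed.

(** An intermediate value theorem drawn from monotonicity: the supremum of the t in [x, y] with t <=
    g t is fixed by g. *)
Lemma cross_fix g x y : x < psi g x -> psi g y < y -> x <= y ->
  exists2 z, x < z < y & psi g z = z.
Proof.
move=> gx gy xy; pose S := [set t | x <= t <= y /\ t <= psi g t].
have Sx : S x by split; rewrite ?lexx // ltW.
have SS : has_sup S by split; [exists x|exists y => t [] /andP[]].
have xs : x <= sup S by apply: ub_le_sup => //; case: SS.
have sy : sup S <= y by apply: ge_sup; [exists x|move=> t [] /andP[]].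
have sup_in : sup S <= psi g (sup S).
  rewrite leNgt; apply/negP => lts.
  have [t [txy tg] ts] := sup_gt (proj1 SS) lts.

  have tsup : t <= sup S by apply: ub_le_sup => //; case: SS.
  by have := le_lt_trans tg (le_lt_trans _ ts); rewrite act_le ltxx => /(_ tsup).
have sup_fix : psi g (sup S) = sup S.
  apply/eqP; rewrite eq_le sup_in andbT leNgt; apply/negP => lts.
  have sy' : sup S < y.
    by rewrite lt_neqAle sy andbT; apply: contraTneq lts => ->; rewrite -leNgt ltW.
  pose t := Order.min y (psi g (sup S)).
  have st : sup S < t by rewrite lt_min sy' lts.
  have : S t.
    split; first by rewrite (le_trans xs (ltW st)) ge_min lexx.
    apply: le_trans (_ : psi g (sup S) <= _); first by rewrite ge_min lexx orbT.
    by rewrite act_le ltW.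
  move=> /(ub_le_sup (proj2 SS)); rewrite leNgt st //.
exists (sup S) => //; rewrite !lt_neqAle xs sy !andbT.
apply/andP; split; apply/eqP => e.
  by move: gx; rewrite {2}e sup_fix -e ltxx.
by move: gy; rewrite -{1}e sup_fix -e ltxx.
Qed.

Lemma sup_fix (g : G) (S : set R) : has_sup S ->
  (forall x, S x -> S (psi g x)) -> (forall x, S x -> S (psi g^-1%g x)) ->
  psi g (sup S) = sup S.
Proof.
move=> SS Sg SV.
have le_sup h : (forall x, S x -> S (psi h^-1%g x)) -> sup S <= psi h (sup S).
  move=> Sh; apply: ge_sup; first by case: SS.
  move=> x Sx; rewrite -(actKV h x) act_le.
  by apply: ub_le_sup; [case: SS|exact: Sh].
apply/eqP; rewrite eq_le le_sup // andbT.
have := le_sup g^-1%g; rewrite invgK => /(_ Sg).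
by rewrite -{1}(act_le g) actKV.
Qed.

End LineAction.

(** * Displacement *)

Section Displacement.
Variables (R : realType) (G : groupType) (psi : G -> R -> R).
Hypothesis Apsi : line_action psi.
Variable E : G -> Prop.
Hypotheses (E1 : E 1%g) (EM : forall g h, E g -> E h -> E (g * h)%g)
  (EV : forall g, E g -> E g^-1%g).

Definition fixed_by (z : R) : Prop := forall e, E e -> psi e z = z.

(** A pair stands for the compact interval between its two coordinates. *)
Definition movable (X : R * R) : Prop :=
  X.1 <= X.2 /\ forall z, fixed_by z -> z < X.1 \/ X.2 < z.

Definition displaces (h : G) (X : R * R) : Prop :=
  X.2 < psi h X.1 \/ psi h X.2 < X.1.

Definition hull (X Y : R * R) : R * R :=
  (Order.min X.1 Y.1, Order.max X.2 Y.2).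

Definition translate (g : G) (X : R * R) : R * R := (psi g X.1, psi g X.2).

(** Otherwise Q bounds the E-orbit of P, whose supremum is a common fixed point of E inside
    [P, Q]. *)
Lemma subgroup_push P Q : movable (P, Q) -> exists2 s, E s & Q < psi s P.
Proof.
move=> [/= PQ mv]; apply: contrapT => H.
have {}H e : E e -> psi e P <= Q.
  by move=> Ee; rewrite leNgt; apply/negP => lt; apply: H; exists e.
pose S := [set psi e P | e in E].
have S0 : S P by exists 1%g; rewrite // (act1 Apsi).
have SS : has_sup S by split; [exists P|exists Q => _ [e Ee <-]; exact: H].
have Sfix : fixed_by (sup S).
  move=> e Ee; apply: (sup_fix Apsi) => // _ [f Ef <-]; rewrite -(actM Apsi).
    by exists (e * f)%g => //; exact: EM.
  by exists (e^-1 * f)%g => //; apply: EM => //; exact: EV.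
have Ps : P <= sup S by apply: ub_le_sup => //; case: SS.
have sQ : sup S <= Q by apply: ge_sup; [exists P|move=> _ [e Ee <-]; exact: H].
by case: (mv _ Sfix); rewrite ltNge ?Ps ?sQ.
Qed.

Lemma movable_translate g X : E g -> movable X -> movable (translate g X).
Proof.
move=> Eg [X12 mv]; split; rewrite /= ?(act_le Apsi) // => z zf.
by case: (mv _ zf) => h; [left|right]; rewrite -(zf g Eg) (act_lt Apsi).
Qed.

(** The last hypothesis puts X and Y in the same gap of the set of common fixed points, and a gap is
    convex. *)
Lemma movable_hull X Y : movable X -> movable Y ->
  (forall z, fixed_by z -> (z < X.1) = (z < Y.1)) -> movable (hull X Y).
Proof.
move=> [X12 mX] [Y12 mY] same; split=> [|z zf] /=.
  by rewrite ge_min le_max X12.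
have := same z zf; have [lt|lt] := mX _ zf; have [lt'|lt'] := mY _ zf => e.
- by left; rewrite lt_min lt lt'.
- by move: e; rewrite lt ltNge (le_trans Y12 (ltW lt')).
- by move: e; rewrite lt' ltNge (le_trans X12 (ltW lt)).
- by right; rewrite gt_max lt lt'.
Qed.

Lemma movable_hull_translate g X : E g -> movable X ->
  movable (hull X (translate g X)).
Proof.
move=> Eg mX; apply: movable_hull => //; first exact: movable_translate.
by move=> z zf /=; rewrite -{2}(zf g Eg) (act_lt Apsi).
Qed.

(* If [s] pushes X to its right and both [h] and [s h s] fail to displace X,
   then the disjoint intervals h X and h s X both reach from s^-1 X to X. *)
Lemma simultaneous_displacement (l : seq (R * R)) :
  (forall X, X \in l -> movable X) ->
  exists2 h, E h & forall X, X \in l -> displaces h X.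
Proof.
have [n] := ubnP (size l); elim: n l => // n IH [|[P Q] l] /= ln Hl.
  by exists 1%g.
have mPQ : movable (P, Q) by apply: Hl; rewrite mem_head.
have [s Es sPQ] := subgroup_push mPQ.
have EsV := EV Es.
(* Displacing this hull makes both h and s h s displace X, so either of them may be chosen to suit
   [P, Q]. *)
pose H X := hull (hull X (translate s X)) (translate s^-1%g X).
have [|X|h Eh hl] := IH [seq H X | X <- l].
- by rewrite size_map; exact: ln.
- case/mapP => Y Yl ->; have mY : movable Y by apply: Hl; rewrite in_cons Yl orbT.
  apply: movable_hull; [exact: movable_hull_translate|exact: movable_translate|].
  move=> z zf /=; rewrite -{2}(zf _ EsV) (act_lt Apsi) lt_min.
  by rewrite -{2}(zf _ Es) (act_lt Apsi) andbb.
have two X : X \in l -> displaces h X /\ displaces (s * h * s)%g X.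
  move=> Xl; have /hl : H X \in [seq H X | X <- l] by apply: map_f.
  rewrite /displaces /= !(actM Apsi) => -[] lt; split; [left|left|right|right].
  + apply: lt_le_trans (_ : psi h (Order.min (Order.min X.1 (psi s X.1)) (psi s^-1%g X.1)) <= _).
      by apply: le_lt_trans lt; rewrite !le_max lexx.
    by rewrite (act_le Apsi) !ge_min lexx.
  + rewrite -(act_ltV Apsi).
    apply: lt_le_trans (_ : psi h (Order.min (Order.min X.1 (psi s X.1)) (psi s^-1%g X.1)) <= _).
      by apply: le_lt_trans lt; rewrite !le_max lexx !orbT.
    by rewrite (act_le Apsi) !ge_min lexx !orbT.
  + apply: le_lt_trans (_ : psi h (Order.max (Order.max X.2 (psi s X.2)) (psi s^-1%g X.2)) < _).
      by rewrite (act_le Apsi) !le_max lexx.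
    by apply: lt_le_trans lt _; rewrite !ge_min lexx.
  + rewrite -(act_gtV Apsi).
    apply: le_lt_trans (_ : psi h (Order.max (Order.max X.2 (psi s X.2)) (psi s^-1%g X.2)) < _).
      by rewrite (act_le Apsi) !le_max lexx !orbT.
    by apply: lt_le_trans lt _; rewrite !ge_min lexx !orbT.
have [dh|ndh] := pselect (displaces h (P, Q)).
  exists h => // X; rewrite in_cons => /orP[/eqP -> //|/two[]//].
exists (s * h * s)%g; first by do !apply: EM.
move=> X; rewrite in_cons => /orP[/eqP ->|/two[]//]; left => /=.
rewrite ltNge; apply: contra_notN ndh; rewrite !(actM Apsi) -(act_le Apsi s^-1%g) actK // => le1.
right => /=; apply: lt_le_trans (_ : psi h (psi s P) <= _); first by rewrite (act_lt Apsi).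
by apply: le_trans le1 _; rewrite ltW // (act_ltV Apsi).
Qed.

(** Once off itself, X keeps moving in the same direction. A power of h can thus be trivial in a
    finite quotient and still displace X. *)
Lemma displacesX h X n : X.1 <= X.2 -> displaces h X ->
  displaces (h ^+ n.+1)%g X.
Proof.
move=> X12; rewrite /displaces => -[lt|lt]; [left|right].
  elim: n => [|n IH]; first by rewrite expg1.
  rewrite expgS (actM Apsi); apply: lt_trans lt _; rewrite (act_lt Apsi).
  exact: le_lt_trans IH.
elim: n => [|n IH]; first by rewrite expg1.
rewrite expgS (actM Apsi); apply: lt_trans lt; rewrite (act_lt Apsi).
exact: lt_le_trans IH _.
Qed.

End Displacement.

(** * Compactness and commuting conjugates *)

(** Cousin's form of compactness, by a supremum argument: a property additive over adjacent
    intervals propagates from short intervals to [u, v]. *)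
Lemma cousin (R : realType) (P : R -> R -> Prop) (u v : R) : u <= v ->
  (forall x y z, x <= y -> y <= z -> P x y -> P y z -> P x z) ->
  (forall x, u <= x <= v -> exists2 eps, 0 < eps &
     forall s t, x - eps < s -> s <= x -> x <= t -> t < x + eps -> P s t) ->
  P u v.
Proof.
move=> uv Ptrans Ploc.
pose S := [set y | u <= y <= v /\ P u y].
have Su : S u.
  split; first by rewrite lexx.
  have [|eps e0 H] := Ploc u; first by rewrite lexx.
  by apply: H; lra.
have SS : has_sup S by split; [exists u|exists v => y [/andP[]]].
have us : u <= sup S by apply: ub_le_sup => //; case: SS.
have sv : sup S <= v by apply: ge_sup; [exists u|move=> y [/andP[]]].
have [|eps e0 Heps] := Ploc (sup S); first by rewrite us.
have [y [/andP[uy yv] Py] ys] : exists2 y, S y & sup S - eps < y.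
  by apply: (sup_gt (proj1 SS)); lra.
have yS : y <= sup S by apply: ub_le_sup; [case: SS|split; rewrite ?uy].
have ext t : sup S <= t -> t < sup S + eps -> P u t.
  by move=> st ts; apply: (Ptrans _ y) => //; [lra|exact: Heps].
have [lt|ge] := ltP (sup S) v; last by apply: ext; lra.
pose t := Order.min v (sup S + eps / 2).
have st : sup S < t by rewrite lt_min lt; lra.
have : S t.
  split; first by rewrite (le_trans us (ltW st)) ge_min lexx.
  by apply: ext; [exact: ltW|rewrite gt_min; apply/orP; right; lra].
by move/(ub_le_sup (proj2 SS)); rewrite leNgt st.
Qed.

(** The points moved by f are permuted by f, and likewise for g; so each map fixes the images under
    the other of the points that the other moves. *)
Lemma disjoint_support_commute (R : realType) (G : groupType)
    (psi : G -> R -> R) (D : R -> Prop) (f g : G) (x : R) :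
  line_action psi -> (forall y, D y -> D (psi f y)) ->
  (forall y, D y -> D (psi g y)) ->
  (forall y, D y -> psi f y <> y -> psi g y = y) -> D x ->
  psi f (psi g x) = psi g (psi f x).
Proof.
move=> Apsi Df Dg dis Dx; have [fx|/eqP nfx] := eqVneq (psi f x) x; last first.
  by rewrite (dis x Dx nfx) (dis _ (Df _ Dx)) // => /(act_inj Apsi).
rewrite fx; have [gx|ngx] := eqVneq (psi g x) x; first by rewrite gx.
apply: contrapT => /(dis _ (Dg _ Dx)) /(act_inj Apsi) e.
by rewrite e eqxx in ngx.
Qed.

Section CommutingConjugate.
Variables (R : realType) (G : groupType) (psi : G -> R -> R).
Hypothesis Apsi : line_action psi.
Variable E : G -> Prop.
Hypotheses (E1 : E 1%g) (EM : forall g h, E g -> E h -> E (g * h)%g)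
  (EV : forall g, E g -> E g^-1%g).
Variables (u v : R).
Hypotheses (uv : u < v) (fix_u : fixed_by psi E u) (fix_v : fixed_by psi E v).

Definition inside (x : R) (X : R * R) : Prop := X.1 <= x <= X.2.

(** Near a common fixed point there is nothing to cover, and any other point has a movable
    neighbourhood; [cousin] extracts a finite list. *)
Lemma movable_cover f :
  (forall z, fixed_by psi E z -> exists2 eps, 0 < eps &
     forall x, `|x - z| < eps -> psi f x = x) ->
  exists2 l : seq (R * R), (forall X, X \in l -> movable psi E X) &
    forall x, u <= x <= v -> psi f x <> x -> exists2 X, X \in l & inside x X.
Proof.
move=> germ.
pose P s t := exists2 l : seq (R * R), (forall X, X \in l -> movable psi E X) &
    forall x, s <= x <= t -> psi f x <> x -> exists2 X, X \in l & inside x X.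
apply: (@cousin _ P); first exact: ltW.
  move=> x y z xy yz [l1 ml1 cl1] [l2 ml2 cl2]; exists (l1 ++ l2).
    by move=> X; rewrite mem_cat => /orP[/ml1|/ml2].
  move=> t /andP[xt tz] ft; have [ty|yt] := leP t y.
    by have [|X Xl iX] := cl1 t _ ft; rewrite ?xt//; exists X; rewrite // mem_cat Xl.
  have [|X Xl iX] := cl2 t _ ft; first by rewrite (ltW yt).
  by exists X; rewrite // mem_cat Xl orbT.
move=> x _; have [xf|nxf] := pselect (fixed_by psi E x).
  have [eps e0 H] := germ _ xf; exists eps => // s t s1 s2 t1 t2.
  exists [::] => // y /andP[y1 y2] fy; case: fy; apply: H.
  by rewrite ltr_norml; apply/andP; split; lra.
(* A common fixed point z <= x satisfies z = e^-1 z <= e^-1 x, and one beyond x lies beyond e x, so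
   none lies strictly between e^-1 x and e x. *)
have [e Ee xe] : exists2 e, E e & x < psi e x.
  apply: contrapT => H; apply: nxf => e Ee; apply/eqP; rewrite eq_le.
  apply/andP; split; rewrite leNgt; apply/negP => lt; apply: H.
    by exists e.
  by exists e^-1%g; [exact: EV|rewrite (act_gtV Apsi)].
have ex : psi e^-1%g x < x by rewrite (act_ltV Apsi).
exists (Order.min (x - psi e^-1%g x) (psi e x - x)); first by rewrite lt_min; lra.
move=> s t s1 s2 t1 t2; exists [:: (s, t)]; last first.
  by move=> y yst _; exists (s, t); rewrite ?mem_head.
move=> X; rewrite inE => /eqP ->; split=> [|z zf] /=; first lra.
have s3 : psi e^-1%g x < s.
  apply: le_lt_trans s1.
  by have : Order.min (x - psi e^-1%g x) (psi e x - x) <= x - psi e^-1%g x;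
     [rewrite ge_min lexx|lra].
have t3 : t < psi e x.
  apply: lt_le_trans t2 _.
  by have : Order.min (x - psi e^-1%g x) (psi e x - x) <= psi e x - x;
     [rewrite ge_min lexx orbT|lra].
have [zx|xz] := leP z x.
  left; apply: le_lt_trans s3; rewrite -(zf e^-1%g (EV Ee)).
  by rewrite (act_le Apsi).
by right; apply: lt_trans t3 _; rewrite -(zf e Ee) (act_lt Apsi).
Qed.

Variables (H : groupType) (rho : G -> H) (N : nat).
Hypotheses (rhoM : forall g h, rho (g * h)%g = (rho g * rho h)%g)
  (rhoN : forall g, (rho g ^+ N.+1 = 1)%g).

(** An element h that is trivial under [rho] moves the finite cover of the support of g f g^-1 off
    that of f. Then f and its conjugate by h g have disjoint supports in [u, v], so they commute by
    faithfulness, and [rho] does not see h. *)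
Lemma commuting_conjugate f g : E f -> E g ->
  (forall k, E k -> (forall x, u <= x <= v -> psi k x = x) -> k = 1%g) ->
  (forall z, fixed_by psi E z -> exists2 eps, 0 < eps &
     forall x, `|x - z| < eps -> psi f x = x) ->
  commute (rho f) (rho (g * f * g^-1)%g).
Proof.
move=> Ef Eg faith germ.
have Euv e x : E e -> (u <= psi e x <= v) = (u <= x <= v).
  by move=> Ee; rewrite -{1}(fix_u Ee) -{1}(fix_v Ee) !(act_le Apsi).
have [l ml cl] := movable_cover germ.
(* Each interval is enlarged by its image under g, so that the list covers the supports of both f
   and g f g^-1 in [u, v]. *)
pose lg := [seq hull X (translate psi g X) | X <- l].
have mlg X : X \in lg -> movable psi E X.
  by case/mapP => Y Yl ->; apply: movable_hull_translate => //; exact: ml.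
(* Only movable hulls can be displaced. Two intervals without movable hull are separated by a common
   fixed point, and h keeps each on its side. *)
pose l2 := [seq Z <- [seq hull X Y | X <- lg, Y <- lg] | `[< movable psi E Z >]].
have [h0 Eh0 disp0] : exists2 h, E h & forall X, X \in l2 -> displaces psi h X.
  apply: (simultaneous_displacement Apsi) => // X.
  by rewrite mem_filter => /andP[/asboolP].
(* The exponent makes [rho h] trivial; by [displacesX] the power still displaces. *)
pose h := (h0 ^+ N.+1)%g.
have rho1 : rho 1%g = 1%g by apply: (mulgI (rho 1%g)); rewrite -rhoM !mulg1.
have rhoX n k : rho (k ^+ n)%g = (rho k ^+ n)%g.
  by elim: n => [|n IH]; rewrite ?expg0 // !expgS rhoM IH.
have rho_h : rho h = 1%g by rewrite rhoX rhoN.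
have Eh : E h.
  by rewrite /h; elim: N.+1 => [|n IH]; rewrite ?expg0 // expgS; exact: EM.
have apart X Y x : X \in lg -> Y \in lg -> inside x X -> ~ inside (psi h x) Y.
  move=> Xl Yl /andP[X1x xX2] /andP[Y1 Y2].
  have [mX mY] := (mlg _ Xl, mlg _ Yl).
  have [mXY|nmXY] := pselect (movable psi E (hull X Y)).
    have /disp0 : hull X Y \in l2.
      by rewrite mem_filter; apply/andP; split; [exact/asboolP|exact: allpairs_f].
    case/(displacesX Apsi N (proj1 mXY)); rewrite -/h /=.
      have le1 : psi h (Order.min X.1 Y.1) <= psi h x.
        by rewrite (act_le Apsi) ge_min X1x.
      by rewrite gt_max => /andP[_ lt]; move: (lt_le_trans lt (le_trans le1 Y2)); rewrite ltxx.
    have le1 : psi h x <= psi h (Order.max X.2 Y.2).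
      by rewrite (act_le Apsi) le_max xX2.
    by rewrite lt_min => /andP[_ lt]; move: (le_lt_trans (le_trans Y1 le1) lt); rewrite ltxx.
  apply: nmXY; apply: movable_hull => // z zf.
  have hz := zf h Eh.
  have [zX1|X2z] := (proj2 mX) z zf; have [zY1|Y2z] := (proj2 mY) z zf.
  - by rewrite zX1 zY1.
  - have : psi h z < psi h x by rewrite (act_lt Apsi) (lt_le_trans zX1).
    by rewrite hz => lt; move: (lt_trans Y2z (lt_le_trans lt Y2)); rewrite ltxx.
  - have : psi h x < psi h z by rewrite (act_lt Apsi) (le_lt_trans xX2).
    by rewrite hz => lt; move: (lt_trans zY1 (le_lt_trans Y1 lt)); rewrite ltxx.
  - by rewrite !ltNge (ltW (le_lt_trans (proj1 mX) X2z)) (ltW (le_lt_trans (proj1 mY) Y2z)).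
pose F := (h * (g * f * g^-1) * h^-1)%g.
have EF : E F by do !(apply: EM => //); exact: EV.
have rhoF : rho F = rho (g * f * g^-1)%g.
  have rhoV : rho h^-1%g = 1%g.
    by apply: (mulIg (rho h)); rewrite -rhoM mulVg rho1 rho_h mulg1.
  by rewrite [LHS]rhoM [rho (h * _)%g]rhoM rho_h rhoV mul1g mulg1.
suff fF : commute f F by rewrite -rhoF /commute -!rhoM fF.
have dis y : u <= y <= v -> psi f y <> y -> psi F y = y.
  move=> yuv fy; apply: contrapT => Fy.
  pose x := psi h^-1%g y; pose t := psi g^-1%g x.
  have yE : y = psi h x by rewrite /x (actKV Apsi).
  have xE : x = psi g t by rewrite /t (actKV Apsi).
  have tuv : u <= t <= v by rewrite Euv ?Euv //; exact: EV.
  have ft : psi f t <> t.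
    by move=> e; apply: Fy; rewrite /F !(actM Apsi) -/x -/t e -xE -yE.
  have [X Xl /andP[X1 X2]] := cl t tuv ft.
  have [Y Yl /andP[Y1 Y2]] := cl y yuv fy.
  have Xg : hull X (translate psi g X) \in lg by apply: map_f.
  have Yg : hull Y (translate psi g Y) \in lg by apply: map_f.
  apply: (apart _ _ x Xg Yg).
    by apply/andP; split; rewrite /= ?ge_min ?le_max xE !(act_le Apsi) ?X1 ?X2 orbT.
  by rewrite -yE; apply/andP; split; rewrite /= ?ge_min ?le_max ?Y1 ?Y2.
have com y : u <= y <= v -> psi f (psi F y) = psi F (psi f y).
  apply: (disjoint_support_commute (D := fun y => is_true (u <= y <= v)) Apsi) => //.
    by move=> z; rewrite Euv.
  by move=> z; rewrite Euv.
have /(mulg1_eq) : (f * F * (F * f)^-1 = 1)%g.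
  apply: faith => [|x xuv]; first by apply: EM; [|apply: EV]; apply: EM.
  set k := (F * f)^-1%g; have Ek : E k by apply: EV; apply: EM.
  rewrite (actM Apsi) [LHS](actM Apsi) com ?Euv // -(actM Apsi).
  exact: (actKV Apsi).
by move/invg_inj.
Qed.

End CommutingConjugate.

(** * Kopell's lemma *)

(* What Kopell's lemma uses of a C^{1+bv} diffeomorphism [F] of [p, q]: the
   mean value theorem, a derivative bounded below whose increments are dominated
   by those of a function [T], and continuity of the derivative at [p]. *)
Definition C1bv_on (R : realType) (F : R -> R) (p q : R) : Prop :=
  exists (DF T : R -> R) (m : R),
  [/\ 0 < m,
      forall x, p <= x <= q -> m <= DF x,
      forall s t, p <= s -> s < t -> t <= q ->
        exists2 xi, s < xi < t & F t - F s = DF xi * (t - s),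
      forall x y, p <= x -> x <= y -> y <= q -> `|DF y - DF x| <= T y - T x &
      forall eps, 0 < eps -> exists2 d, 0 < d &
        forall x, p <= x <= q -> x < p + d -> `|DF x - DF p| < eps].

Section Kopell.
Variables (R : realType) (G : groupType) (psi : G -> R -> R).
Hypothesis Apsi : line_action psi.

Lemma orbit_pull g p q x0 y : support_comp psi g p q ->
  (forall x, p < x < q -> psi g x < x) -> p < x0 < q -> p < y ->
  exists n, psi (g ^+ n)%g x0 < y.
Proof.
move=> [pq gp gq _] dec /andP[px xq] py.
have [lt|le] := ltP x0 y; first by exists 0%N; rewrite expg0 (act1 Apsi).
have [x /andP[yx xx0]|n ltn] := orbit_push Apsi (g := g^-1%g) le.
  rewrite (act_gtV Apsi); apply: dec.
  by rewrite (lt_le_trans py) //= (le_lt_trans xx0).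
by exists n; rewrite -(act_gtV Apsi) -expVgn.
Qed.

Lemma orbit_invariant g p q x n : psi g p = p -> psi g q = q ->
  (p < psi (g ^+ n)%g x < q) = (p < x < q).
Proof. by move=> gp gq; apply: act_between => //; exact: actX_fix. Qed.

Section Distortion.
Variables (g : G) (p q x0 : R).
Hypotheses (cg : support_comp psi g p q) (x0pq : p < x0 < q)
  (dec : forall x, p < x < q -> psi g x < x).

(** The intervals g^i [g x0, x0] have disjoint interiors, so the oscillations of the derivative on
    them add up to at most [T x0 - T p]. Dividing by the lower bound m bounds the logarithm of the
    ratio of lengths; the inequality is this bound cleared of denominators. *)
Lemma denjoy_distortion : C1bv_on (psi g) p q ->
  exists2 K, 0 < K & forall n s t s' t',
    psi g x0 <= s -> s < t -> t <= x0 ->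
    psi g x0 <= s' -> s' < t' -> t' <= x0 ->
    (psi (g ^+ n)%g t - psi (g ^+ n)%g s) * (t' - s') <=
    K * ((t - s) * (psi (g ^+ n)%g t' - psi (g ^+ n)%g s')).
Proof.
case=> DF [T [m [m0 mDF mvt TDF _]]].
have [pq gp gq _] := cg.
pose x n := psi (g ^+ n)%g x0.
have xpq n : p < x n < q by rewrite orbit_invariant.
have Tx n : T (x n.+1) <= T (x n).
  have /andP[p1 q1] := xpq n.+1; have /andP[p2 q2] := xpq n.
  have lt : x n.+1 <= x n by rewrite /x expgS (actM Apsi) ltW // dec; [|exact: xpq].
  by rewrite -subr_ge0; apply: le_trans (TDF _ _ (ltW p1) lt (ltW q2)).
exists (expR ((T x0 - T p) / m)) => [|n s t s' t' s0 st t0 s0' st' t0']; first exact: expR_gt0.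
(* The induction carries the telescoped constant of the first n intervals; [T p] replaces [T (x n)]
   only at the end. *)
have Kn : (psi (g ^+ n)%g t - psi (g ^+ n)%g s) * (t' - s') <=
    expR ((T x0 - T (x n)) / m) * ((t - s) * (psi (g ^+ n)%g t' - psi (g ^+ n)%g s')).
  elim: n => [|n IH].
    by rewrite /x !expg0 !(act1 Apsi) subrr mul0r expR0 mul1r.
  set S := psi (g ^+ n)%g s in IH *; set U := psi (g ^+ n)%g t in IH *.
  set S' := psi (g ^+ n)%g s' in IH *; set U' := psi (g ^+ n)%g t' in IH *.
  have step z : psi (g ^+ n.+1)%g z = psi g (psi (g ^+ n)%g z).
    by rewrite expgS (actM Apsi).
  rewrite !step -/S -/U -/S' -/U'.
  have lo z : psi g x0 <= z -> x n.+1 <= psi (g ^+ n)%g z.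
    by move=> h; rewrite /x expgSr (actM Apsi) (act_le Apsi).
  have hi z : z <= x0 -> psi (g ^+ n)%g z <= x n by rewrite (act_le Apsi).
  have [SU SU'] : S < U /\ S' < U' by rewrite !(act_lt Apsi).
  have /andP[p1 _] := xpq n.+1; have /andP[_ q2] := xpq n.
  have L := lo s s0; have H := hi t t0; have L' := lo s' s0'; have H' := hi t' t0'.
  rewrite -/S -/U -/S' -/U' in L H L' H'.
  have [xi /andP[xi1 xi2] ->] := mvt S U ltac:(lra) SU ltac:(lra).
  have [xi' /andP[xi1' xi2'] ->] := mvt S' U' ltac:(lra) SU' ltac:(lra).
  have D : DF xi <= DF xi' + (T (x n) - T (x n.+1)).
    have var y z : x n.+1 <= y -> y <= z -> z <= x n ->
        `|DF z - DF y| <= T (x n) - T (x n.+1).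
      move=> a b c; have := TDF y z ltac:(lra) b ltac:(lra).
      have := le_trans (normr_ge0 _) (TDF (x n.+1) y ltac:(lra) a ltac:(lra)).
      have := le_trans (normr_ge0 _) (TDF z (x n) ltac:(lra) c ltac:(lra)).
      lra.
    have [le|le] := leP xi xi'.
      have := var xi xi' ltac:(lra) le ltac:(lra); rewrite distrC.
      by move=> /(le_trans (ler_norm _)); lra.
    have := var xi' xi ltac:(lra) (ltW le) ltac:(lra).
    by move=> /(le_trans (ler_norm _)); lra.
  have m' : m <= DF xi' by apply: mDF; apply/andP; split; lra.
  set d := T (x n) - T (x n.+1) in D.
  have d0 : 0 <= d by rewrite subr_ge0.
  (* From 1 <= DF xi' / m and 1 + t <= exp t. *)
  have DE : DF xi <= DF xi' * expR (d / m).
    apply: le_trans D _; apply: le_trans (_ : DF xi' * (1 + d / m) <= _).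
      have -> : DF xi' * (1 + d / m) = DF xi' + DF xi' / m * d by field; lra.
      rewrite lerD2l -{1}[d]mul1r; apply: ler_wpM2r => //.
      by rewrite ler_pdivlMr // mul1r.
    apply: ler_wpM2l; first lra.
    exact: expR_ge1Dx.
  have -> : (T x0 - T (x n.+1)) / m = d / m + (T x0 - T (x n)) / m by rewrite /d; ring.
  rewrite expRD.
  set e1 := expR _ in DE *; set e2 := expR _ in IH *.
  have e2p : 0 < e2 by exact: expR_gt0.
  have B : 0 <= (U - S) * (t' - s') by apply: mulr_ge0; lra.
  have p0 : 0 <= DF xi' * e1.
    by apply: mulr_ge0; [lra|rewrite ltW // expR_gt0].
  have := ler_wpM2r B DE; have := ler_wpM2l p0 IH; lra.
apply: le_trans Kn _; apply: ler_wpM2r.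
  apply: mulr_ge0; first lra.
  by rewrite subr_ge0 (act_le Apsi) ltW.
rewrite ler_expR; apply: ler_wpM2r; first by rewrite invr_ge0 ltW.
have /andP[p1 q1] := xpq n.
have := le_trans (normr_ge0 _) (TDF p (x n) (lexx p) (ltW p1) (ltW q1)); lra.
Qed.

End Distortion.

(** The orbit is bounded by the fixed point x0; after a point within eta of the supremum, the next
    one cannot exceed the supremum. *)
Lemma orbit_small_step h x0 y eta : psi h x0 = x0 -> y < x0 -> 0 < eta ->
  exists j, psi (h ^+ j.+1)%g y - psi (h ^+ j)%g y < eta.
Proof.
move=> hx0 yx0 eta0; pose S := range (fun j => psi (h ^+ j)%g y).
have S0 : S !=set0 by exists y, 0%N; rewrite // expg0 (act1 Apsi).
have Sub : has_ubound S.
  by exists x0 => _ [j _ <-]; rewrite -(actX_fix Apsi j hx0) (act_le Apsi) ltW.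
have [_ [j _ <-] jS] : exists2 z, S z & sup S - eta < z by apply: sup_gt => //; lra.
exists j; have : psi (h ^+ j.+1)%g y <= sup S by apply: ub_le_sup => //; exists j.+1.
lra.
Qed.

(* The intervals h^j [y, h y] become small, while h^j has derivative 1 at [p]:
   after many iterations of g all of them have nearly the same length, against
   the bound on distortion. *)
Lemma kopell_fundamental_domain g h p q x0 y : support_comp psi g p q ->
  (forall x, p < x < q -> psi g x < x) -> commute g h ->
  p < x0 < q -> psi h x0 = x0 -> (forall k, C1bv_on (psi k) p q) ->
  psi g x0 <= y -> y < x0 -> y < psi h y -> False.
Proof.
move=> cg dec com x0pq hx0 reg y0 yx0 yhy; have [pq gp gq _] := cg.
have [K K0 dist] := denjoy_distortion cg x0pq dec (reg g).
have hgx0 : psi h (psi g x0) = psi g x0 by rewrite -(act_comm Apsi _ com) hx0.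
have hy : psi h y <= x0 by rewrite -hx0 (act_le Apsi) ltW.
(* This makes K times the length of h^j [y, h y] less than half the length of [y, h y]; the half is
   matched below by the derivative of h^j. *)
have [|j Bj] := @orbit_small_step h x0 y ((psi h y - y) / (2 * K)) hx0 yx0.
  by rewrite divr_gt0; lra.
pose k := (h ^+ j)%g.
have kfix z : psi h z = z -> psi k z = z by move=> ?; exact: actX_fix.
have comX n : commute (g ^+ n)%g h by apply: commute_sym; apply: commuteX; exact: commute_sym.
have comk n : commute (g ^+ n)%g k by apply: commuteX.
have hxn n : psi h (psi (g ^+ n)%g x0) = psi (g ^+ n)%g x0.
  by rewrite -(act_comm Apsi _ (comX n)) hx0.
have xpq n : p < psi (g ^+ n)%g x0 < q by rewrite orbit_invariant.
have [DF [_ [_ [_ _ mvt _ cont]]]] := reg k.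
(* The tolerance 1/4 is used twice: h^j has derivative 1 somewhere between its fixed points g^(n+1)
   x0 and g^n x0, so its derivative exceeds 3/4 at p, hence 1/2 on the points of [p, q] below p +
   d. *)
have [|d d0 Hd] := cont (1 / 4); first lra.
have [|n xnd] := orbit_pull cg dec x0pq (y := p + d); first lra.
have /andP[pn qn] := xpq n; have /andP[pn1 qn1] := xpq n.+1.
have stepn z : psi (g ^+ n.+1)%g z = psi (g ^+ n)%g (psi g z).
  by rewrite expgSr (actM Apsi).
have xn1n : psi (g ^+ n.+1)%g x0 < psi (g ^+ n)%g x0.
  by rewrite stepn (act_lt Apsi); exact: dec.
have [xi /andP[xi1 xi2]] := mvt _ _ (ltW pn1) xn1n (ltW qn).
rewrite !kfix // -[LHS]mul1r => /mulIf xiE.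
have {}xiE : 1 = DF xi by apply: xiE; lra.
have := Hd xi; rewrite -xiE => /(_ ltac:(apply/andP; split; lra) ltac:(lra)).
rewrite ltr_norml => /andP[_ DFp].
have An1 : psi (g ^+ n.+1)%g x0 <= psi (g ^+ n)%g y by rewrite stepn (act_le Apsi).
have An2 : psi (g ^+ n)%g (psi h y) <= psi (g ^+ n)%g x0 by rewrite (act_le Apsi).
have An3 : psi (g ^+ n)%g y < psi (g ^+ n)%g (psi h y) by rewrite (act_lt Apsi).
have [z /andP[z1 z2] zE] := mvt _ _ (ltac:(lra) : p <= psi (g ^+ n)%g y) An3 ltac:(lra).
have := Hd z ltac:(apply/andP; split; lra) ltac:(lra).
rewrite ltr_norml => /andP[DFz _].
have kle a b : psi g x0 <= a -> a < b -> b <= x0 ->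
    psi g x0 <= psi k a /\ psi k a < psi k b /\ psi k b <= x0.
  by move=> *; rewrite -{1}(kfix _ hgx0) -{2}(kfix _ hx0) !(act_le Apsi) (act_lt Apsi).
have [B1 [B2 B3]] := kle y (psi h y) y0 yhy hy.
have := dist n _ _ _ _ B1 B2 B3 y0 yhy hy.
rewrite !(act_comm Apsi _ (comk n)) zE.
have -> : psi k (psi h y) = psi (h ^+ j.+1)%g y by rewrite expgSr (actM Apsi).
move: Bj B2 An3; rewrite -/k.
have -> : psi k (psi h y) = psi (h ^+ j.+1)%g y by rewrite expgSr (actM Apsi).
set B := psi (h ^+ j.+1)%g y - psi k y; set A := psi h y - y.
set C := psi (g ^+ n)%g _ - psi (g ^+ n)%g _ => BA B0 C0.
have A0 : 0 < A by rewrite subr_gt0.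
have {}C0 : 0 < C by rewrite subr_gt0.
apply/negP; rewrite -ltNge; apply: lt_trans (_ : 1 / 2 * C * A < _); last first.
  apply: (lt_le_trans _ (_ : (DF z * C) * A <= _)) => //.
  by rewrite ltr_pM2r // ltr_pM2r //; lra.
have -> : K * (B * C) = (K * B) * C by ring.
have -> : 1 / 2 * C * A = (A / 2) * C by ring.
rewrite ltr_pM2r //; move: BA; rewrite ltr_pdivlMr; lra.
Qed.

(** A fixed point x of h forces h to be the identity on [g x, x], by the preceding lemma for h and
    h^-1. The g-images of [g x0, x0] fill (p, x0], and points above x0 are first pulled below it by
    a power of g. *)
Lemma kopell_dec g h p q x0 y : support_comp psi g p q ->
  (forall x, p < x < q -> psi g x < x) -> commute g h ->
  p < x0 < q -> psi h x0 = x0 -> (forall k, C1bv_on (psi k) p q) ->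
  p < y < q -> psi h y = y.
Proof.
move=> cg dec com x0pq hx0 reg ypq; have [pq gp gq _] := cg.
have comX n : commute (g ^+ n)%g h by apply: commute_sym; apply: commuteX; exact: commute_sym.
have xpq n x : p < x < q -> p < psi (g ^+ n)%g x < q by rewrite orbit_invariant.
have main x z : p < x < q -> psi h x = x -> psi g x <= z -> z < x -> psi h z = z.
  move=> xx hx z1 z2; apply/eqP; rewrite eq_le !leNgt.
  apply/andP; split; apply/negP => lt.
    exact: (kopell_fundamental_domain cg dec com xx hx reg z1 z2 lt).
  apply: (@kopell_fundamental_domain g h^-1%g p q x z) => //.
  - exact: commuteV.
  - exact: act_fixV.
  - by rewrite (act_gtV Apsi).
have below z : p < z < q -> z < x0 -> psi h z = z.
  move=> /andP[pz zq] zx0.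
  have ex : exists n, psi (g ^+ n)%g x0 <= z.
    by have [n /ltW] := orbit_pull cg dec x0pq pz; exists n.
  case: (ex_minnP ex) => -[|n] le min.
    by move: le; rewrite expg0 (act1 Apsi) leNgt zx0.
  apply: (main (psi (g ^+ n)%g x0)).
  - exact: xpq.
  - by rewrite -(act_comm Apsi _ (comX n)) hx0.
  - by rewrite -(actM Apsi) -expgS.
  - by rewrite ltNge; apply/negP => /min; rewrite ltnn.
have [lt|le] := ltP y x0; first exact: below.
have /andP[px0 _] := x0pq.
have [n ltn] := orbit_pull cg dec ypq px0.
by apply: (act_inj Apsi (g := (g ^+ n)%g)); rewrite (act_comm Apsi _ (comX n)) below // xpq.
Qed.

(** A change of sign would produce a fixed point by [cross_fix], applied to g or g^-1 according to
    the order of the two points. *)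
Lemma support_comp_sign g p q : support_comp psi g p q ->
  (forall x, p < x < q -> psi g x < x) \/ (forall x, p < x < q -> x < psi g x).
Proof.
move=> [pq gp gq free]; pose x0 := (p + q) / 2.
have x0pq : p < x0 < q by rewrite /x0; apply/andP; split; lra.
have [lt|ge] := ltP (psi g x0) x0; [left|right] => x xpq; rewrite ltNge.
  apply/negP; rewrite le_eqVlt => /predU1P[e|gt]; first by case: (free x xpq).
  have [le|le] := leP x x0.
    have [z /andP[z1 z2]] := cross_fix Apsi gt lt le; apply: free; lra.
  have [||z /andP[z1 z2]] := cross_fix Apsi (g := g^-1%g) _ _ (ltW le).
  - by rewrite (act_gtV Apsi).
  - by rewrite (act_ltV Apsi).
  - by move/(act_fixV Apsi); rewrite invgK; apply: free; lra.
have gt : x0 < psi g x0 by rewrite lt_neqAle ge andbT; apply/eqP => e; case: (free x0).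
apply/negP; rewrite le_eqVlt => /predU1P[e|lt]; first by case: (free x xpq).
have [le|le] := leP x0 x.
  have [z /andP[z1 z2]] := cross_fix Apsi gt lt le; apply: free; lra.
have [||z /andP[z1 z2]] := cross_fix Apsi (g := g^-1%g) _ _ (ltW le).
- by rewrite (act_gtV Apsi).
- by rewrite (act_ltV Apsi).
- by move/(act_fixV Apsi); rewrite invgK; apply: free; lra.
Qed.

Lemma kopell g h p q x0 y : support_comp psi g p q -> commute g h ->
  (forall k, C1bv_on (psi k) p q) ->
  p < x0 < q -> psi h x0 = x0 -> p < y < q -> psi h y = y.
Proof.
move=> cg com reg x0pq hx0 ypq; have [pq gp gq free] := cg.
have [dec|inc] := support_comp_sign cg.
exact: (kopell_dec cg dec com x0pq).
apply: (@kopell_dec g^-1%g h p q x0) => //.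
- split=> //; [exact: act_fixV|exact: act_fixV|].
  by move=> x xpq /(act_fixV Apsi); rewrite invgK; exact: free.
- by move=> x xpq; rewrite (act_ltV Apsi); exact: inc.
- by apply: commute_sym; apply: commuteV; exact: commute_sym.
Qed.

End Kopell.

(** * Hoelder's theorem *)

(** The form in which the smoothness enters the dynamical argument from here on. *)
Definition kopell_property (R : realType) (G : groupType)
    (psi : G -> R -> R) : Prop :=
  forall g h p q x y, support_comp psi g p q -> commute g h ->
    p < x < q -> psi h x = x -> p < y < q -> psi h y = y.

(* Hoelder's argument: the order given by the action on (p, q) is Archimedean
   and bi-invariant. *)
Section Hoelder.
Variables (R : realType) (G : groupType) (psi : G -> R -> R).
Hypotheses (Apsi : line_action psi) (Kpsi : kopell_property psi).
Variables (d : G) (p q : R).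
Hypothesis cd : support_comp psi d p q.

Let C (k : G) : Prop := [/\ commute d k, psi k p = p & psi k q = q].
Let I (x : R) : Prop := p < x < q.
Let lt (k l : G) : Prop := forall x, I x -> psi k x < psi l x.
Let le (k l : G) : Prop := forall x, I x -> psi k x <= psi l x.

Let x0 : R := (p + q) / 2.

Let Ix0 : I x0.
Proof. by rewrite /I /x0; case: cd => pq _ _ _; apply/andP; split; lra. Qed.

Let C1 : C 1%g.
Proof. by split; rewrite ?(act1 Apsi) //; exact: commute1. Qed.

Let CM k l : C k -> C l -> C (k * l)%g.
Proof.
move=> [dk kp kq] [dl lp lq]; split; first exact: commuteM.
  exact: act_fixM.
exact: act_fixM.
Qed.

Let CV k : C k -> C k^-1%g.
Proof. by move=> [dk kp kq]; split; [exact: commuteV|exact: act_fixV|exact: act_fixV]. Qed.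

Let CX k n : C k -> C (k ^+ n)%g.
Proof. by move=> Ck; elim: n => [|n IH]; rewrite ?expg0 // expgS; exact: CM. Qed.

Let CI k x : C k -> I (psi k x) = I x.
Proof. by move=> [_ kp kq]; rewrite /I (act_between Apsi). Qed.

(** If k^-1 l fixes a point of (p, q), Kopell's lemma against d makes it the identity there;
    otherwise its displacement has constant sign. *)
Lemma hoelder_trichotomy k l : C k -> C l ->
  [\/ lt k l, lt l k | forall x, I x -> psi k x = psi l x].
Proof.
move=> Ck Cl; have Cm : C (k^-1 * l)%g by apply: CM => //; exact: CV.
have [[x Ix mx]|nfix] := pselect (exists2 x, I x & psi (k^-1 * l)%g x = x).
  apply: Or33 => y Iy; have [dm _ _] := Cm.
  have := Kpsi cd dm Ix mx Iy; rewrite (actM Apsi) => /(congr1 (psi k)).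
  by rewrite (actKV Apsi).
have [pq _ _ _] := cd; have [_ mp mq] := Cm.
have [|dec|inc] := @support_comp_sign _ _ _ Apsi (k^-1 * l)%g p q.
- by split=> // x Ix e; apply: nfix; exists x.
- by apply: Or32 => x Ix; rewrite -(act_ltV Apsi) -(actM Apsi); exact: dec.
- by apply: Or31 => x Ix; rewrite -(act_gtV Apsi) -(actM Apsi); exact: inc.
Qed.

Lemma hoelder_ltVle k l : C k -> C l -> lt k l \/ le l k.
Proof.
move=> Ck Cl; case: (hoelder_trichotomy Ck Cl) => H; [by left|right|right] => x Ix.
  exact/ltW/H.
by rewrite H.
Qed.

Lemma hoelder_lt_le k l : lt k l -> le l k -> False.
Proof. by move=> /(_ _ Ix0) + /(_ _ Ix0); rewrite ltNge => /negP. Qed.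

(** The Archimedean property: powers of e push the midpoint of (p, q) past its image by g, and one
    point decides the order. *)
Lemma hoelder_floor e g : C e -> C g -> lt 1%g e -> le 1%g g ->
  exists n, le (e ^+ n)%g g /\ lt g (e ^+ n.+1)%g.
Proof.
move=> Ce Cg e1 g1.
have ex : exists n, `[< lt g (e ^+ n)%g >].
  have x0g : x0 <= psi g x0 by rewrite -{1}(act1 Apsi x0); exact: g1.
  have /andP[_ gq] : I (psi g x0) by rewrite CI.
  have [|n ltn] := orbit_push Apsi x0g (g := e).
    move=> x /andP[xx0 xg]; rewrite -{1}(act1 Apsi x); apply: e1.
    have /andP[px0 _] := Ix0.
    by rewrite /I (lt_le_trans px0) // (le_lt_trans xg).
  exists n; apply/asboolP; case: (hoelder_ltVle Cg (CX n Ce)) => // /(_ _ Ix0).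
  by rewrite leNgt ltn.
case: (ex_minnP ex) => -[|n] /asboolP ltn min.
  by case: (hoelder_lt_le ltn); rewrite expg0.
exists n; split=> //; case: (hoelder_ltVle Cg (CX n Ce)) => // /asboolP /min.
by rewrite ltnn.
Qed.

(** Let k be the commutator, so that g h = k h g. If some positive f has f^2 <= k, bracketing g and
    h between successive powers of f gives g h < f^(m+n+2) <= k h g. Otherwise k is the least
    positive element, g and h act on (p, q) as powers of k, and they commute there. *)
Lemma hoelder_no_positive_commutator g h : C g -> C h -> le 1%g g -> le 1%g h ->
  lt 1%g (g * h * (h * g)^-1)%g -> False.
Proof.
move=> Cg Ch g1 h1; set k := (_ * _^-1)%g => k1.
have Ck : C k by apply: CM; [|apply: CV]; exact: CM.
have kE x : psi k (psi h (psi g x)) = psi g (psi h x).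
  by rewrite -!(actM Apsi) -mulgA /k mulgVK.
clearbody k.
have [[e [Ce e1 ek]]|min] := pselect (exists e, [/\ C e, lt 1%g e & lt e k]).
  (* Either e itself or e^-1 k has its square at most k. *)
  have [f [Cf f1 fk]] : exists f, [/\ C f, lt 1%g f & le (f * f)%g k].
    have [lte|ge] := hoelder_ltVle Ck (CM Ce Ce); last by exists e.
    exists (e^-1 * k)%g; split; first by apply: CM => //; exact: CV.
      move=> x Ix; rewrite (act1 Apsi) (actM Apsi) (act_gtV Apsi); exact: ek.
    move=> x Ix; rewrite !(actM Apsi).
    have Ikx : I (psi k x) by rewrite CI.
    set t := psi e^-1%g (psi k x); have It : I t by rewrite CI //; exact: CV.
    have -> : psi k x = psi e t by rewrite /t (actKV Apsi).
    by rewrite ltW // (act_ltV Apsi) -(actM Apsi); exact: lte.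
  have [m [mg gm]] := hoelder_floor Cf Cg f1 g1.
  have [n [nh hn]] := hoelder_floor Cf Ch f1 h1.
  have Ihx : I (psi h x0) by rewrite CI.
  have Igx : I (psi g x0) by rewrite CI.
  have Ihgx : I (psi h (psi g x0)) by rewrite CI.
  have lt1 : psi g (psi h x0) < psi (f ^+ m.+1)%g (psi (f ^+ n.+1)%g x0).
    by apply: lt_trans (gm _ Ihx) _; rewrite (act_lt Apsi); exact: hn.
  have le2 : psi (f ^+ n)%g (psi (f ^+ m)%g x0) <= psi h (psi g x0).
    by apply: le_trans (nh _ Igx); rewrite (act_le Apsi); exact: mg.
  have := fk _ Ihgx; rewrite kE leNgt => /negP; apply.
  apply: lt_le_trans lt1 _.
  rewrite -[leLHS](actM Apsi) -expgnDr addSn addnS.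
  apply: le_trans (_ : psi (f * f)%g (psi (f ^+ n)%g (psi (f ^+ m)%g x0)) <= _).
    by rewrite -!(actM Apsi) -!mulgA -expgnDr -!expgS addnC.
  by rewrite (act_le Apsi).
have power g' : C g' -> le 1%g g' -> exists n, forall x, I x -> psi g' x = psi (k ^+ n)%g x.
  move=> Cg' g1'; have [n [ng gn]] := hoelder_floor Ck Cg' k1 g1'; exists n => x Ix.
  case: (hoelder_trichotomy Cg' (CX n Ck)) => [lt1|lt1|]; last by apply.
    by case: (hoelder_lt_le lt1).
  case: min; exists ((k ^+ n)^-1 * g')%g; split.
  - by apply: CM => //; apply: CV; exact: CX.
  - by move=> y Iy; rewrite (act1 Apsi) (actM Apsi) (act_gtV Apsi); exact: lt1.
  - move=> y Iy; rewrite (actM Apsi) (act_ltV Apsi) -(actM Apsi) -expgSr; exact: gn.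
have [m gE] := power g Cg g1; have [n hE] := power h Ch h1.
have Ihx : I (psi h x0) by rewrite CI.
have Igx : I (psi g x0) by rewrite CI.
have Ihgx : I (psi h (psi g x0)) by rewrite CI.
have := k1 _ Ihgx; rewrite (act1 Apsi) kE (gE _ Ihx) (hE _ Igx) (gE _ Ix0) (hE _ Ix0).
by rewrite -!(actM Apsi) -!expgnDr addnC ltxx.
Qed.

(** For g and h nonnegative, neither the commutator nor its inverse, the commutator in the other
    order, can be positive. Passing to inverses gives the other signs. *)
Lemma hoelder_commute g h x : commute d g -> commute d h ->
  psi g p = p -> psi g q = q -> psi h p = p -> psi h q = q ->
  p < x < q -> psi g (psi h x) = psi h (psi g x).
Proof.
move=> dg dh gp gq hp hq Ix.
have {dg gp gq}Cg : C g by []; have {dh hp hq}Ch : C h by [].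
have pos g' h' : C g' -> C h' -> le 1%g g' -> le 1%g h' ->
    forall y, I y -> psi g' (psi h' y) = psi h' (psi g' y).
  move=> Cg' Ch' g1 h1 y Iy.
  have Ck : C (g' * h' * (h' * g')^-1)%g by apply: CM; [|apply: CV]; exact: CM.
  case: (hoelder_trichotomy C1 Ck) => [k1|k1|k1].
  - by case: (hoelder_no_positive_commutator Cg' Ch' g1 h1 k1).
  - case: (hoelder_no_positive_commutator Ch' Cg' h1 g1) => z Iz.
    rewrite (act1 Apsi) -[(h' * g')%g]invgK -invgM (act_gtV Apsi) -[X in _ < X](act1 Apsi).
    exact: k1.
  - have Ihg : I (psi (h' * g')%g y) by rewrite CI //; exact: CM.
    have := k1 _ Ihg; rewrite (act1 Apsi) -[RHS](actM Apsi) mulgVK !(actM Apsi).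
    by move=> ->.
have posh g' : C g' -> le 1%g g' -> forall y, I y -> psi g' (psi h y) = psi h (psi g' y).
  move=> Cg' g1 y Iy; case: (hoelder_ltVle Ch C1) => [lt1|]; last by move=> h1; exact: pos.
  have Iy' : I (psi h y) by rewrite CI.
  apply: (act_inj Apsi (g := h^-1%g)); rewrite (actK Apsi).
  rewrite -(pos g' h^-1%g) ?(actK Apsi) //; first exact: CV.
  by move=> z Iz; rewrite (act1 Apsi) ltW // (act_gtV Apsi) -[X in _ < X](act1 Apsi); exact: lt1.
case: (hoelder_ltVle Cg C1) => [lt1|]; last by move=> g1; exact: posh.
have Ix' : I (psi g x) by rewrite CI.
apply: (act_inj Apsi (g := g^-1%g)); rewrite (actK Apsi).
rewrite posh ?(actK Apsi) //; first exact: CV.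
by move=> z Iz; rewrite (act1 Apsi) ltW // (act_gtV Apsi) -[X in _ < X](act1 Apsi); exact: lt1.
Qed.

End Hoelder.

(** * Germs at a global fixed point *)

Lemma raag_gen_commute (V : choiceType) (e : rel V) (u v : V) :
  e u v -> commute (raag_gen e u) (raag_gen e v).
Proof.
move=> euv; rewrite /commute.
have E (x y : raag e) : (x * y)%g = raag_mul x y by [].
by rewrite !E /raag_gen !raag_mulE; apply/raag_eqP; exact: We_comm.
Qed.

Lemma raag_ind (V : choiceType) (e : rel V) (P : raag e -> Prop) :
  P 1%g -> (forall g h, P g -> P h -> P (g * h)%g) ->
  (forall v, P (raag_gen e v)) -> (forall v, P (raag_gen e v)^-1%g) ->
  forall g, P g.
Proof.
move=> P1 PM Pgen PgenV g; rewrite -[g]reprK.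
elim: (generic_quotient.repr g) => [|[v s] w IH]; first exact: P1.
have -> : \pi_(raag e)%qT ((v, s) :: w) =
    (\pi_(raag e)%qT [:: (v, s)] * \pi_(raag e)%qT w)%g.
  by rewrite -[RHS]/(raag_mul _ _) raag_mulE.
apply: PM IH; case: s; first exact: Pgen.
suff <- : (raag_gen e v)^-1%g = \pi_(raag e)%qT [:: (v, false)] by exact: PgenV.
apply: mulg1_eq; rewrite -[LHS]/(raag_mul _ _) raag_mulE.
by apply/raag_eqP; exact: (We_cancel e v true).
Qed.

Lemma last_fixed (R : realType) (G : groupType) (psi : G -> R -> R) g x t :
  line_action psi -> t <= x -> psi g t = t -> psi g x <> x ->
  exists p, [/\ p < x, psi g p = p & forall y, p < y -> y <= x -> psi g y <> y].
Proof.
move=> Apsi tx gt gx; pose S := [set y | y <= x /\ psi g y = y].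
have St : S t by [].
have SS : has_sup S by split; [exists t|exists x => y []].
have supx : sup S <= x by apply: ge_sup; [exists t|move=> y []].
have sup_fixed : psi g (sup S) = sup S.
  apply: (sup_fix Apsi SS) => y [yx gy].
    by rewrite /S /= !gy.
  by rewrite /S /= (act_fixV Apsi gy).
exists (sup S); split=> // [|y lt yx gy].
  by rewrite lt_neqAle supx andbT; apply/eqP => e; apply: gx; rewrite -e.
by have := ub_le_sup (proj2 SS) (conj yx gy : S y); rewrite leNgt lt.
Qed.

Lemma support_comp_exists (R : realType) (G : groupType) (psi : G -> R -> R)
    g x s t : line_action psi -> s <= x -> x <= t -> psi g s = s ->
  psi g t = t -> psi g x <> x ->
  exists p q, support_comp psi g p q /\ p < x < q.
Proof.
move=> Apsi sx xt gs gt gx.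
have [p [px gp pfree]] := last_fixed Apsi sx gs gx.
(* The right end point is a left end point of the mirrored action. *)
have [||||q [qx gq qfree]] := @last_fixed _ _ (mirror psi) g (- x) (- t).
- exact: act_mirror.
- by rewrite lerN2.
- by rewrite /mirror opprK gt.
- by rewrite /mirror opprK => /oppr_inj.
have {}gq : psi g (- q) = - q by rewrite -{2}gq /mirror opprK.
exists p, (- q); split; last by rewrite px ltrNr.
split=> // [|y /andP[py yq] gy]; first by rewrite (lt_trans px) // ltrNr.
have [yx|xy] := leP y x; first exact: (pfree y).
apply: (qfree (- y)); first by rewrite ltrNr.
  by rewrite lerN2 ltW.
by rewrite /mirror opprK gy.
Qed.

Local Notation gena := (A_P4_gen va).
Local Notation genb := (A_P4_gen vb).
Local Notation genc := (A_P4_gen vc).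
Local Notation gend := (A_P4_gen vd).
Local Notation elt_u := (genc * genb * gena * genb^-1 * genc^-1)%g.
Local Notation elt_w := (elt_u * gend * elt_u^-1 * gend^-1)%g.

Lemma P4_commute u v : P4_edge u v -> commute (A_P4_gen u) (A_P4_gen v).
Proof. exact: raag_gen_commute. Qed.

Section TameAction.
Variables (R : realType) (psi : A_P4 -> R -> R).
Hypotheses (Apsi : line_action psi) (Kpsi : kopell_property psi).
Hypothesis Fpsi : forall v x,
  (exists2 s, s <= x & psi (A_P4_gen v) s = s) /\
  (exists2 t, x <= t & psi (A_P4_gen v) t = t).

Lemma gen_support_comp v x : psi (A_P4_gen v) x <> x ->
  exists p q, support_comp psi (A_P4_gen v) p q /\ p < x < q.
Proof.
by have [[s sx vs] [t xt vt]] := Fpsi v x; exact: support_comp_exists vs vt.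
Qed.

(** If the generator moved p, Kopell's lemma on its support interval around p would make g, which
    fixes p, the identity there; but that interval meets (p, q). The same holds at q. *)
Lemma gen_fixes_endpoints g v p q : support_comp psi g p q ->
  commute (A_P4_gen v) g ->
  psi (A_P4_gen v) p = p /\ psi (A_P4_gen v) q = q.
Proof.
move=> [pq gp gq free] com; split; apply: contrapT => /gen_support_comp.
  move=> [s [t [st /andP[sp pt]]]].
  pose m := Order.min q t; have pm : p < m by rewrite lt_min pq.
  have [mq mt] : m <= q /\ m <= t by rewrite !ge_min !lexx orbT.
  apply: (free ((p + m) / 2)); first by apply/andP; split; lra.
  by apply: (Kpsi st com (x := p)); rewrite ?sp //; apply/andP; split; lra.
move=> [s [t [st /andP[sp pt]]]].
pose m := Order.max p s; have pm : m < q by rewrite gt_max pq.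
have [mq mt] : p <= m /\ s <= m by rewrite !le_max !lexx orbT.
apply: (free ((q + m) / 2)); first by apply/andP; split; lra.
by apply: (Kpsi st com (x := q)); rewrite ?sp //; apply/andP; split; lra.
Qed.

Lemma same_or_disjoint g v p q : support_comp psi g p q ->
  commute (A_P4_gen v) g ->
  (forall x, p < x < q -> psi (A_P4_gen v) x = x) \/
  support_comp psi (A_P4_gen v) p q.
Proof.
move=> sg com.
have [[x xpq vx]|nf] := pselect (exists2 x, p < x < q & psi (A_P4_gen v) x = x).
  by left=> y; apply: Kpsi sg (commute_sym com) xpq vx.
right; have [vp vq] := gen_fixes_endpoints sg com.
by have [pq _ _ _] := sg; split=> // x xpq vx; apply: nf; exists x.
Qed.

Definition common_comp (p q : R) : Prop :=
  support_comp psi gena p q /\ support_comp psi gend p q.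

Lemma common_comp_exists x : psi gena x <> x -> psi gend x <> x ->
  exists p q, common_comp p q /\ p < x < q.
Proof.
move=> ax dx; have [p [q [sa xpq]]] := gen_support_comp ax.
exists p, q; split=> //; split=> //.
by have [/(_ x xpq)|//] := same_or_disjoint sa (@P4_commute vd va isT).
Qed.

(** Each of b and c commutes with one of d and a. *)
Lemma common_comp_fixed v p q : common_comp p q ->
  psi (A_P4_gen v) p = p /\ psi (A_P4_gen v) q = q.
Proof.
move=> [sa sd]; case: v.
- by case: sa.
- exact: gen_fixes_endpoints sd (@P4_commute vb vd isT).
- exact: gen_fixes_endpoints sa (@P4_commute vc va isT).
- by case: sd.
Qed.

Lemma common_comp_invariant g p q x : common_comp p q ->
  (p < psi g x < q) = (p < x < q).
Proof.
move=> cpq; suff [gp gq] : psi g p = p /\ psi g q = q by exact: act_between.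
elim/raag_ind: g => [|g h [gp gq] [hp hq]|v|v].
- by rewrite !(act1 Apsi).
- by split; exact: act_fixM.
- exact: common_comp_fixed.
- by have [? ?] := common_comp_fixed v cpq; split; exact: act_fixV.
Qed.

(** Both a and b commute with d, so by Hoelder's theorem they commute on a support interval of d;
    and c commutes with a. *)
Lemma elt_u_common p q x : common_comp p q -> p < x < q ->
  psi elt_u x = psi gena x.
Proof.
move=> cpq xpq; have [sa sd] := cpq.
have [ap aq] := common_comp_fixed va cpq.
have [bp bq] := common_comp_fixed vb cpq.
have ab y : p < y < q -> psi gena (psi genb y) = psi genb (psi gena y).
  move=> ypq; apply: (hoelder_commute Apsi Kpsi sd) => //; first exact: (@P4_commute vd va).
  exact: (@P4_commute vd vb).
rewrite !(actM Apsi) -ab; last by rewrite !(common_comp_invariant _ _ cpq).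
rewrite (actKV Apsi) (act_comm Apsi); last exact: (@P4_commute vc va).
by rewrite (actKV Apsi).
Qed.

Lemma elt_w_common p q x : common_comp p q -> p < x < q -> psi elt_w x = x.
Proof.
move=> cpq xpq; have inv g y := common_comp_invariant g y cpq.
rewrite (actM Apsi) [LHS](actM Apsi) [LHS](actM Apsi).
set y := psi elt_u^-1%g _; have ypq : p < y < q by rewrite !inv.
rewrite (elt_u_common cpq) ?inv // (act_comm Apsi); last exact: (@P4_commute va vd).
by rewrite -(elt_u_common cpq) // /y !(actKV Apsi).
Qed.

(* Such an [x] lies in a support interval of a, which cb maps to an interval
   meeting a support interval of d; the two differ since d fixes [x]. *)
Definition bad (x : R) : Prop :=
  [/\ psi gena x <> x, psi gend x = x &
      psi gend (psi (genc * genb)%g x) <> psi (genc * genb)%g x].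

Section Germ.
Variable z : R.
Hypothesis fix_z : forall g, psi g z = z.

Let above g x : (z < psi g x) = (z < x).
Proof. by rewrite -{1}(fix_z g) (act_lt Apsi). Qed.

Lemma isolated_fixed_support_comp v eps : 0 < eps ->
  ~ (exists2 x, z < x < z + eps & psi (A_P4_gen v) x = x) ->
  exists q, support_comp psi (A_P4_gen v) z q.
Proof.
move=> eps0 nf; have [x0z|p [q [sv /andP[px xq]]]] := @gen_support_comp v (z + eps / 2).
  by apply: nf; exists (z + eps / 2) => //; apply/andP; split; lra.
have [pq vp vq free] := sv; exists q; suff -> : z = p by [].
apply/eqP; rewrite eq_le !leNgt; apply/andP; split; apply/negP => lt.
  by apply: (free z) => //; apply/andP; split; lra.
by apply: nf; exists p => //; apply/andP; split; lra.
Qed.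

(** The conjugate u d u^-1 is trivial wherever u^-1 leads back into (z, q), so w is trivial near
    z. *)
Lemma elt_w_germ_d q : z < q -> (forall x, z < x < q -> psi gend x = x) ->
  exists2 eps, 0 < eps & forall x, z < x < z + eps -> psi elt_w x = x.
Proof.
move=> zq dq; exists (Order.min q (psi elt_u q) - z).
  by rewrite subr_gt0 lt_min zq above.
move=> y /andP[zy]; rewrite addrC subrK lt_min => /andP[yq yuq].
rewrite (actM Apsi) [LHS](actM Apsi) [LHS](actM Apsi).
have -> : psi gend^-1%g y = y by apply: (act_fixV Apsi); apply: dq; rewrite zy.
by rewrite dq ?(actKV Apsi) // above zy (act_ltV Apsi).
Qed.

(** Conjugation by cb makes u trivial on (z, cb q), hence also w near z. *)
Lemma elt_w_germ_a q : z < q -> (forall x, z < x < q -> psi gena x = x) ->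
  exists2 eps, 0 < eps & forall x, z < x < z + eps -> psi elt_w x = x.
Proof.
move=> zq aq; pose r := psi (genc * genb)%g q.
have uE y : z < y < r -> psi elt_u y = y.
  move=> /andP[zy yr]; rewrite -mulgA -invgM [LHS](actM Apsi) [LHS](actM Apsi).
  by rewrite aq ?(actKV Apsi) // above zy (act_ltV Apsi).
have zr : z < r by rewrite above.
exists (Order.min r (psi gend r) - z); first by rewrite subr_gt0 lt_min zr above.
move=> y /andP[zy]; rewrite addrC subrK lt_min => /andP[yr ydr].
rewrite (actM Apsi) [LHS](actM Apsi) [LHS](actM Apsi).
set y' := psi gend^-1%g y.
have -> : psi elt_u^-1%g y' = y'.
  by apply: (act_fixV Apsi); apply: uE; rewrite above zy (act_ltV Apsi).
by rewrite (actKV Apsi) uE // zy.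
Qed.

Lemma elt_w_germ_common q : common_comp z q ->
  exists2 eps, 0 < eps & forall x, z < x < z + eps -> psi elt_w x = x.
Proof.
move=> cq; exists (q - z) => [|x]; first by rewrite subr_gt0; case: cq => -[].
by rewrite addrC subrK => xq; exact: elt_w_common cq xq.
Qed.

(** Let y near z be moved by u and d. Then (cb)^-1 y is moved by a, and also by d since it is not
    bad; it lies in a common support interval, which cb preserves. So near z the supports of u and d
    meet only where u acts as a, and there u commutes with d. *)
Lemma elt_w_germ_not_bad r : z < r -> (forall x, z < x < r -> ~ bad x) ->
  exists2 eps, 0 < eps & forall x, z < x < z + eps -> psi elt_w x = x.
Proof.
move=> zr nb; pose r1 := psi (genc * genb)%g r.
have zr1 : z < r1 by rewrite above.
have common y : z < y < r1 -> psi elt_u y <> y -> psi gend y <> y ->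
    exists p q, common_comp p q /\ p < y < q.
  move=> /andP[zy yr1] uy dy; pose x := psi (genc * genb)^-1%g y.
  have yE : y = psi (genc * genb)%g x by rewrite /x (actKV Apsi).
  have ax : psi gena x <> x.
    move=> ax; apply: uy; rewrite -mulgA -invgM [LHS](actM Apsi) [LHS](actM Apsi).
    by rewrite -/x ax -yE.
  have dx : psi gend x <> x.
    move=> dx; apply: (nb x); first by rewrite above zy (act_ltV Apsi).
    by split=> //; rewrite -yE.
  have [p [q [cpq xpq]]] := common_comp_exists ax dx.
  by exists p, q; split=> //; rewrite yE (common_comp_invariant _ _ cpq).
(* The three bounds keep y, u^-1 y and d^-1 y below r1. *)
exists (Order.min r1 (Order.min (psi elt_u r1) (psi gend r1)) - z).
  by rewrite subr_gt0 !lt_min !above zr.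
move=> y /andP[zy]; rewrite addrC subrK !lt_min => /andP[yr1 /andP[yur ydr]].
rewrite (actM Apsi) [LHS](actM Apsi) [LHS](actM Apsi).
have [dy|/eqP dy] := eqVneq (psi gend y) y.
  rewrite (act_fixV Apsi dy); set y' := psi elt_u^-1%g y.
  have yE : psi elt_u y' = y by rewrite /y' (actKV Apsi).
  have [dy'|/eqP dy'] := eqVneq (psi gend y') y'; first by rewrite dy'.
  have uy' : psi elt_u y' <> y' by rewrite yE => e; rewrite -e in dy'.
  have [|p [q [cpq ypq]]] := common y' _ uy' dy'; first by rewrite above zy (act_ltV Apsi).
  have [_ _ _ /(_ y) free] := proj2 cpq; case: free => //.
  by rewrite -yE (common_comp_invariant _ _ cpq).
set y' := psi gend^-1%g y; have yE : psi gend y' = y by rewrite /y' (actKV Apsi).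
have dy' : psi gend y' <> y' by move=> e; apply: dy; rewrite -yE e.
have zy' : z < y' < r1 by rewrite above zy (act_ltV Apsi).
have [uy'|/eqP uy'] := eqVneq (psi elt_u y') y'.
  rewrite (act_fixV Apsi uy') yE; apply: contrapT => uy.
  have [|p [q [cpq ypq]]] := common y _ uy dy; first by rewrite zy.
  case: (proj1 cpq) => _ _ _ /(_ y'); apply; first by rewrite (common_comp_invariant _ _ cpq).
  by rewrite -(elt_u_common cpq) // (common_comp_invariant _ _ cpq).
have [p [q [cpq ypq]]] := common y' zy' uy' dy'.
rewrite -[RHS](elt_w_common cpq (x := y)) ?(actM Apsi) //.
by rewrite -yE (common_comp_invariant _ _ cpq).
Qed.

(** Without nearby fixed points of a, or of d, the point z is an end of a support interval of that
    generator, on which the other one is trivial or has the same support; either way w is trivial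
    near z. *)
Lemma elt_w_germ_or_bad :
  (exists2 eps, 0 < eps & forall x, z < x < z + eps -> psi elt_w x = x) \/
  forall eps, 0 < eps ->
    [/\ exists2 x, z < x < z + eps & psi gena x = x,
        exists2 x, z < x < z + eps & psi gend x = x &
        exists2 x, z < x < z + eps & bad x].
Proof.
have [|ngerm] := pselect (exists2 eps, 0 < eps &
  forall x, z < x < z + eps -> psi elt_w x = x); [by left|right] => eps eps0.
split; apply: contrapT => nf; apply: ngerm.
- have [q sa] := isolated_fixed_support_comp eps0 nf; have [zq _ _ _] := sa.
  have [dq|sd] := same_or_disjoint sa (@P4_commute vd va isT).
    exact: elt_w_germ_d zq dq.
  exact: (@elt_w_germ_common q).
- have [q sd] := isolated_fixed_support_comp eps0 nf; have [zq _ _ _] := sd.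
  have [aq|sa] := same_or_disjoint sd (@P4_commute va vd isT).
    exact: elt_w_germ_a zq aq.
  exact: (@elt_w_germ_common q).
- apply: (@elt_w_germ_not_bad (z + eps)); first lra.
  by move=> x xz bx; apply: nf; exists x.
Qed.

End Germ.

(** The generator moving z can only be c or d, and both commute with a: Kopell's lemma applies on
    its support interval around z. *)
Lemma gena_germ z v : psi gena z = z -> psi genb z = z ->
  psi (A_P4_gen v) z <> z ->
  exists2 eps, 0 < eps & forall x, `|x - z| < eps -> psi gena x = x.
Proof.
move=> az bz vz; have com : commute (A_P4_gen v) gena.
  case: v vz => vz; [by case: vz|by case: vz| |]; exact: P4_commute.
have [p [q [sv zpq]]] := gen_support_comp vz; have /andP[pz zq] := zpq.
exists (Order.min (z - p) (q - z)); first by rewrite lt_min; lra.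
move=> x; rewrite lt_min !ltr_norml => /andP[/andP[h1 h2] /andP[h3 h4]].
by apply: (Kpsi sv com zpq az); lra.
Qed.

End TameAction.

(** * A finite quotient *)

Section RaagAction.
Variables (V : choiceType) (e : rel V) (T : Type) (L : V -> bool -> T -> T).
Hypotheses (LK : forall v s, cancel (L v (~~ s)) (L v s))
  (Lcomm : forall u v x, e u v -> L u true (L v true x) = L v true (L u true x)).

(** The universal property of the group, for actions given on letters and their inverses; it yields
    both the finite quotient and the lift to the line. *)
Definition word_act (w : word V) (x : T) : T := foldr (fun l => L l.1 l.2) x w.

Lemma word_act_equiv w1 w2 : word_equiv e w1 w2 -> word_act w1 =1 word_act w2.
Proof.
elim=> {w1 w2} [w|w1 w2 _ IH|w1 w2 w3 _ IH1 _ IH2|u1 u2 w1 w2 _ IHu _ IHw|v s|u v euv] x //.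
- by rewrite IH1.
- by rewrite /word_act !foldr_cat -/(word_act w1 x) IHw; exact: IHu.
- exact: LK.
- exact: Lcomm.
Qed.

Definition raag_act (g : raag e) : T -> T := word_act (generic_quotient.repr g).

Lemma raag_actM g h x : raag_act (g * h)%g x = raag_act g (raag_act h x).
Proof.
rewrite /raag_act /word_act -foldr_cat.
exact: (word_act_equiv (raag_reprK e _)).
Qed.

Lemma raag_act1 x : raag_act 1%g x = x.
Proof. exact: (word_act_equiv (raag_reprK e [::])). Qed.

Lemma raag_act_gen v x : raag_act (raag_gen e v) x = L v true x.
Proof. exact: (word_act_equiv (raag_reprK e [:: (v, true)])). Qed.

Lemma raag_act_genV v x : raag_act (raag_gen e v)^-1%g x = L v false x.
Proof.
rewrite -[X in raag_act _ X](LK v true) -raag_act_gen -raag_actM mulVg.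
by rewrite raag_act1.
Qed.

End RaagAction.

(** The non-edges of the graph form the path a, b, c, d, and successive transpositions overlap
    exactly along it. *)
Definition P4_transposition (v : P4_vertex) : {perm 'I_5} :=
  let o i (h : (i < 5)%N) := Ordinal h in
  match v with
  | va => tperm (o 0%N isT) (o 1%N isT)
  | vb => tperm (o 1%N isT) (o 2%N isT)
  | vc => tperm (o 2%N isT) (o 3%N isT)
  | vd => tperm (o 3%N isT) (o 4%N isT)
  end.

Lemma P4_transpositionK v : involutive (mulg (P4_transposition v)).
Proof. by move=> x; rewrite mulgA; case: v; rewrite tperm2 mul1g. Qed.

Lemma P4_transposition_commute u v : P4_edge u v ->
  commute (P4_transposition u) (P4_transposition v).
Proof.
case: u v => -[] // _; apply/permP => -[[|[|[|[|[|//]]]]] i5];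
  by rewrite !permM /P4_transposition; do ?[rewrite !permE /=]; exact: val_inj.
Qed.

(** Left multiplication on the symmetric group, evaluated at 1; a letter and its inverse act alike,
    transpositions being involutions. *)
Definition P4_rho (g : A_P4) : {perm 'I_5} :=
  raag_act (fun v (_ : bool) x => (P4_transposition v * x)%g) g 1%g.

Lemma P4_rho_act (g : A_P4) x :
  raag_act (fun v (_ : bool) x => (P4_transposition v * x)%g) g x = (P4_rho g * x)%g.
Proof.
rewrite /P4_rho /raag_act; elim: (generic_quotient.repr g) => [|l w IH] /=.
  by rewrite mul1g.
by rewrite IH mulgA.
Qed.

Lemma P4_rhoM (g h : A_P4) : P4_rho (g * h)%g = (P4_rho g * P4_rho h)%g.
Proof.
rewrite {1}/P4_rho raag_actM ?P4_rho_act ?mulg1 //; first by move=> v _; exact: P4_transpositionK.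
by move=> u v x /P4_transposition_commute uv; rewrite !mulgA uv.
Qed.

Lemma P4_rho1 : P4_rho 1%g = 1%g.
Proof. by apply: (mulgI (P4_rho 1%g)); rewrite -P4_rhoM !mulg1. Qed.

Lemma P4_rho_gen v : P4_rho (A_P4_gen v) = P4_transposition v.
Proof.
rewrite /P4_rho raag_act_gen ?mulg1 //; first by move=> w _; exact: P4_transpositionK.
by move=> u w x /P4_transposition_commute uw; rewrite !mulgA uw.
Qed.

Lemma P4_rho_genV v : P4_rho (A_P4_gen v)^-1%g = P4_transposition v.
Proof.
rewrite /P4_rho raag_act_genV ?mulg1 //; first by move=> w _; exact: P4_transpositionK.
by move=> u w x /P4_transposition_commute uw; rewrite !mulgA uw.
Qed.

(** The exponent is the order of the symmetric group, written as a successor to fit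
    [commuting_conjugate]. *)
Lemma P4_rho_exp (g : A_P4) :
  (P4_rho g ^+ #|[set: {perm 'I_5}]%G|.-1.+1 = 1)%g.
Proof. by rewrite prednK ?cardG_gt0 // expg_cardG // inE. Qed.

(** The transpositions (01) and (02) do not commute. *)
Lemma P4_rho_gena_ncommute :
  ~ commute (P4_rho gena) (P4_rho (genb * gena * genb^-1)%g).
Proof.
rewrite !P4_rhoM P4_rho_genV !P4_rho_gen => /permP /(_ ord0).
by rewrite !permM /P4_transposition; do ?[rewrite !permE /=]; move=> /(congr1 val).
Qed.

(** The image of u is (03), so that of w is a 3-cycle on 0, 3, 4; conjugation by (01) gives a
    3-cycle on 1, 3, 4, and two such cycles do not commute. *)
Lemma P4_rho_elt_w_ncommute :
  ~ commute (P4_rho elt_w) (P4_rho (gena * elt_w * gena^-1)%g).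
Proof.
rewrite !(invMg, invgK) !P4_rhoM !P4_rho_genV !P4_rho_gen.
move=> /permP /(_ (Ordinal (isT : (0 < 5)%N))); rewrite !permM /=.
do 60?[rewrite tpermL | rewrite tpermR | rewrite [fun_of_perm _ (Ordinal _)]tpermD //].
by move=> /(congr1 val).
Qed.

(** * Reflection, and existence of accumulating bad points *)

Section Mirror.
Variables (R : realType) (G : groupType) (psi : G -> R -> R).

Lemma mirror_fix g x : (mirror psi g (- x) = - x) <-> (psi g x = x).
Proof. by rewrite /mirror opprK; split=> [/oppr_inj|->]. Qed.

Lemma mirror_fixN g x : (mirror psi g x = x) <-> (psi g (- x) = - x).
Proof. by rewrite -mirror_fix opprK. Qed.

Lemma mirror_kopell : kopell_property psi -> kopell_property (mirror psi).
Proof.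
move=> K g h p q x y [pq gp gq free] com /andP[px xq] hx /andP[py yq].
have cN : support_comp psi g (- q) (- p).
  split; [by rewrite ltrN2|exact/mirror_fixN|exact/mirror_fixN|].
  move=> t /andP[t1 t2] /mirror_fix; apply: free.
  by rewrite ltrNr t2 ltrNl t1.
apply/mirror_fixN; apply: (K _ _ _ _ (- x) _ cN com).
- by rewrite !ltrN2 px xq.
- exact/mirror_fixN.
- by rewrite !ltrN2 py yq.
Qed.

End Mirror.

(** The relation [near] is instantiated by the one-sided neighbourhoods of a point, on its right or
    on its left. *)
Definition bad_side (R : realType) (psi : A_P4 -> R -> R) (near : R -> R -> Prop) : Prop :=
  forall eps, 0 < eps ->
    [/\ exists2 x, near eps x & psi gena x = x,
        exists2 x, near eps x & psi gend x = x &
        exists2 x, near eps x & bad psi x].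

Section GlobalBad.
Variables (R : realType) (psi : A_P4 -> R -> R).
Hypotheses (Apsi : line_action psi) (Kpsi : kopell_property psi).
Hypothesis Fpsi : forall v x,
  (exists2 s, s <= x & psi (A_P4_gen v) s = s) /\
  (exists2 t, x <= t & psi (A_P4_gen v) t = t).
Hypothesis Wpsi : forall t0, exists u v : R, [/\ u < v,
  forall g, psi g t0 = t0 -> psi g u = u /\ psi g v = v &
  forall g, psi g t0 = t0 -> (forall x, u <= x <= v -> psi g x = x) -> g = 1%g].

Lemma bad_mirror x : bad (mirror psi) x <-> bad psi (- x).
Proof.
have E g y : (mirror psi g y = y) = (psi g (- y) = - y).
  by apply/propext; exact: mirror_fixN.
by rewrite /bad !E /mirror !opprK.
Qed.

Lemma elt_w_germ_or_bad_sides z : (forall g, psi g z = z) ->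
  [\/ exists2 eps, 0 < eps & forall x, `|x - z| < eps -> psi elt_w x = x,
      bad_side psi (fun eps x => z < x < z + eps) |
      bad_side psi (fun eps x => z - eps < x < z)].
Proof.
move=> fz; have [[e1 e10 H1]|] := elt_w_germ_or_bad Apsi Kpsi Fpsi fz; last by move=> ?; apply: Or32.
have fNz g : mirror psi g (- z) = - z by apply/mirror_fix.
have FN v x :
    (exists2 s, s <= x & mirror psi (A_P4_gen v) s = s) /\
    (exists2 t, x <= t & mirror psi (A_P4_gen v) t = t).
  have [[s sx vs] [t xt vt]] := Fpsi v (- x); split.
    by exists (- t); [rewrite lerNl|apply/mirror_fix].
  by exists (- s); [rewrite lerNr|apply/mirror_fix].
have [[e2 e20 H2]|H] := elt_w_germ_or_bad (act_mirror Apsi) (mirror_kopell Kpsi) FN fNz.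
  apply: Or31; exists (Order.min e1 e2); first by rewrite lt_min e10.
  move=> x; rewrite lt_min !ltr_norml => /andP[/andP[a1 a2] /andP[a3 a4]].
  have [lt|lt|->] := ltgtP x z; last exact: fz.
    by apply/mirror_fix; apply: H2; apply/andP; split; lra.
  by apply: H1; apply/andP; split; lra.
apply: Or33 => eps e0; have [[x xz ax] [y yz dy] [t tz bt]] := H eps e0.
split; [exists (- x)|exists (- y)|exists (- t)].
- by move: xz => /andP[]; lra.
- exact/mirror_fixN.
- by move: yz => /andP[]; lra.
- exact/mirror_fixN.
- by move: tz => /andP[]; lra.
- exact/bad_mirror.
Qed.

(** [commuting_conjugate] is used with f = w conjugated by a when there is a global fixed point, and
    otherwise with f = a conjugated by b in the stabilizer of [t0]. *)
Lemma bad_points : exists2 z, forall g, psi g z = z &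
  bad_side psi (fun eps x => z < x < z + eps) \/
  bad_side psi (fun eps x => z - eps < x < z).
Proof.
have [[z0 fz0]|nfix] := pselect (exists z, forall g, psi g z = z).
  have [u [v [uv fuv faith]]] := Wpsi z0.
  apply: contrapT => nbad; apply: P4_rho_elt_w_ncommute.
  apply: (@commuting_conjugate _ _ _ Apsi (fun=> True) _ _ _ u v _ _ _ _ _ _ P4_rhoM P4_rho_exp) => //.
  - by move=> e _; have [] := fuv e (fz0 e).
  - by move=> e _; have [] := fuv e (fz0 e).
  - by move=> k _; exact: faith.
  - move=> z fz; have {}fz g : psi g z = z by exact: fz.
    have [//|H|H] := elt_w_germ_or_bad_sides fz; case: nbad; exists z => //.
      by left.
    by right.
(* By faithfulness d acts nontrivially, its image (34) being nontrivial. *)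
have [x dx] : exists x, psi gend x <> x.
  apply: contrapT => /forallNP dx; have {}dx x : psi gend x = x by exact: contrapT.
  have [u [v [_ _ faith]]] := Wpsi 0.
  have /(congr1 P4_rho) := faith gend (dx 0) (fun x _ => dx x).
  rewrite P4_rho_gen P4_rho1 => /permP /(_ (Ordinal (isT : (3 < 5)%N))).
  by rewrite permE perm1 /= => /(congr1 val).
have [t0 [q [sd _]]] := gen_support_comp Apsi Fpsi dx.
have [at0 _] := gen_fixes_endpoints Apsi Kpsi Fpsi sd (@P4_commute va vd isT).
have [bt0 _] := gen_fixes_endpoints Apsi Kpsi Fpsi sd (@P4_commute vb vd isT).
have [u [v [uv fuv faith]]] := Wpsi t0.
case: P4_rho_gena_ncommute.
apply: (@commuting_conjugate _ _ _ Apsi (fun g => psi g t0 = t0) _ _ _ u v _ _ _ _ _ _ P4_rhoM P4_rho_exp) => //.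
- exact: (act1 Apsi).
- by move=> g h; exact: act_fixM.
- by move=> g; exact: act_fixV.
- by move=> e et0; have [] := fuv e et0.
- by move=> e et0; have [] := fuv e et0.
(* The stabilizer contains a and b, so z is fixed by both; were it fixed by c and d too, it would be
   a global fixed point. *)
- move=> z fz; have [[w wz]|nw] := pselect (exists w, psi (A_P4_gen w) z <> z).
    by apply: (gena_germ Apsi Kpsi Fpsi _ _ wz); exact: fz.
  have gz w : psi (A_P4_gen w) z = z by apply: contrapT => wz; apply: nw; exists w.
  case: nfix; exists z; elim/raag_ind => [|g h|w|w].
  + exact: (act1 Apsi).
  + exact: act_fixM.
  + exact: gz.
  + by apply: act_fixV => //; exact: gz.
Qed.

End GlobalBad.

(** * The two sequences of intervals *)

Definition matching (X : topologicalType) (phi : A_P4 -> X -> X) : Prop :=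
  exists I_a I_d : nat -> set X,
    [/\ forall j, pi0 (supp (phi gena)) (I_a j),
        forall j, pi0 (supp (phi gend)) (I_d j),
        forall j k, j <> k -> I_a j <> I_a k,
        forall j k, j <> k -> I_d j <> I_d k &
        forall j, I_a j <> I_d j /\
          (phi (genc * genb)%g @` I_a j) `&` I_d j !=set0].

Section Matching.
Variables (R : realType) (X : topologicalType) (phi : A_P4 -> X -> X).

Definition component (v : P4_vertex) (x : X) : set X :=
  connected_component (supp (phi (A_P4_gen v))) x.

(* The condition on [z] is there for the circle, where one fixed point does not
   disconnect. *)
Definition separates_right (pi : R -> X) (psi : A_P4 -> R -> R) : Prop :=
  forall v z s x t, psi (A_P4_gen v) z = z -> psi (A_P4_gen v) x = x ->
    psi (A_P4_gen v) s <> s -> psi (A_P4_gen v) t <> t ->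
    z < s -> s < x -> x < t -> t < z + 1 ->
    component v (pi s) <> component v (pi t).

(** Bad points are chosen one after the other, each so close to z that a fixed point of a separates
    it from the previous ones, and a fixed point of d separates their images under cb. *)
Lemma matching_right (pi : R -> X) (psi : A_P4 -> R -> R) (z : R) :
  line_action psi -> (forall g x, pi (psi g x) = phi g (pi x)) ->
  (forall v x, psi (A_P4_gen v) x <> x ->
     phi (A_P4_gen v) (pi x) <> pi x) ->
  separates_right pi psi ->
  (forall g, psi g z = z) -> bad_side psi (fun eps x => z < x < z + eps) ->
  matching phi.
Proof.
move=> Apsi equi moved sep fz badz; pose cb := (genc * genb)%g.
have above g x : (z < psi g x) = (z < x) by rewrite -{1}(fz g) (act_lt Apsi).
(* The pair holds a bad point below [beta] and the threshold for the next choice; the value (0, 0)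
   is a dummy for [beta] <= z. *)
have step beta : exists xb : R * R, z < beta ->
    [/\ z < xb.1 < beta, bad psi xb.1, z < xb.2 <= beta,
        forall y, y < xb.2 -> exists2 s, psi gena s = s & y < s < xb.1 &
        forall y, y < xb.2 -> exists2 s, psi gend s = s & psi cb y < s < psi cb xb.1].
  have [zb|] := ltP z beta; last by exists (0, 0).
  have [|_ _ [x]] := badz (beta - z); first by rewrite subr_gt0.
  rewrite addrC subrK => /andP[zx xb] bx.
  have [|[s] + as_ _ _] := badz (x - z); first by rewrite subr_gt0.
  rewrite addrC subrK => /andP[zs sx].
  have [|_ [t] + dt _] := badz (psi cb x - z); first by rewrite subr_gt0 above.
  rewrite addrC subrK => /andP[zt tx].
  exists (x, Order.min s (psi cb^-1%g t)) => _ /=; split=> //.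
  - by rewrite zx.
  - by rewrite lt_min zs above zt ge_min (ltW (lt_trans sx xb)).
  - by move=> y; rewrite lt_min => /andP[ys _]; exists s; rewrite // ys.
  - move=> y; rewrite lt_min => /andP[_ yt]; exists t; rewrite // tx andbT.
    by rewrite -(act_gtV Apsi).
have [F HF] := choice step.
(* The initial threshold keeps all bad points and their images under cb in (z, z + 1), as
   [separates_right] demands. *)
pose beta n := iter n (fun b => (F b).2) (Order.min (z + 1) (psi cb^-1%g (z + 1))).
pose x n := (F (beta n)).1.
have zbeta n : z < beta n.
  elim: n => [|n IH]; first by rewrite lt_min above ltrDl ltr01.
  by have [_ _ /andP[]] := HF _ IH.
have beta_le n m : (n <= m)%N -> beta m <= beta n.
  elim: m => [|m IH]; first by rewrite leqn0 => /eqP ->.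
  rewrite leq_eqVlt => /predU1P[->//|/IH]; apply: le_trans.
  by have [_ _ /andP[]] := HF _ (zbeta m).
have xP n := HF _ (zbeta n).
have zx n : z < x n by have [/andP[]] := xP n.
have xbad n : bad psi (x n) by have [] := xP n.
have x_lt n m : (n < m)%N -> x m < beta n.+1.
  by move=> nm; apply: lt_le_trans (beta_le _ _ nm); have [/andP[]] := xP m.
have x_lt0 n : x n < z + 1 /\ psi cb (x n) < z + 1.
  have : x n < beta 0%N by apply: lt_le_trans (beta_le _ _ (leq0n n)); have [/andP[]] := xP n.
  by rewrite lt_min -(act_gtV Apsi) => /andP[].
have moved_in v y : psi (A_P4_gen v) y <> y -> component v (pi y) (pi y).
  by move=> /moved; exact: connected_component_refl.
have sub v y : component v y `<=` supp (phi (A_P4_gen v)).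
  exact: connected_component_sub.
have distinct_a n m : (n < m)%N -> component va (pi (x m)) <> component va (pi (x n)).
  move=> nm; have [_ _ _ /(_ _ (x_lt _ _ nm)) [s as_ /andP[s1 s2]] _] := xP n.
  have [am _ _] := xbad m; have [an _ _] := xbad n.
  by apply: (sep va z _ s _) => //; case: (x_lt0 n).
have distinct_d n m : (n < m)%N ->
    component vd (pi (psi cb (x m))) <> component vd (pi (psi cb (x n))).
  move=> nm; have [_ _ _ _ /(_ _ (x_lt _ _ nm)) [s ds /andP[s1 s2]]] := xP n.
  have [_ _ dm] := xbad m; have [_ _ dn] := xbad n.
  by apply: (sep vd z _ s _) => //; [rewrite above|case: (x_lt0 n)].
exists (fun n => component va (pi (x n))), (fun n => component vd (pi (psi cb (x n)))).
split.
- by move=> n; exists (pi (x n)) => //; apply: moved; case: (xbad n).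
- by move=> n; exists (pi (psi cb (x n))) => //; apply: moved; case: (xbad n).
- move=> j k /eqP; rewrite neq_ltn => /orP[lt|lt]; last exact: distinct_a.
  by move=> e; apply: (distinct_a _ _ lt).
- move=> j k /eqP; rewrite neq_ltn => /orP[lt|lt]; last exact: distinct_d.
  by move=> e; apply: (distinct_d _ _ lt).
(* The chosen point lies in its support interval of a but is fixed by d, so the two intervals
   differ. *)
- move=> j; have [aj dj cj] := xbad j; split.
    move=> e; have := moved_in va _ aj; rewrite e => /sub; apply.
    by rewrite /Fix /= -equi dj.
  exists (pi (psi cb (x j))); split; last exact: moved_in.
  by exists (pi (x j)); [exact: moved_in|rewrite equi].
Qed.

End Matching.

(* In [lift_window], [u, v] is [0, 1] or a fundamental domain of the circle. *)
Record line_lift (R : realType) (X : topologicalType) (phi : A_P4 -> X -> X)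
    (pi : R -> X) (psi : A_P4 -> R -> R) : Prop := LineLift {
  lift_line : line_action psi;
  lift_C1bv : forall g p q, support_comp psi g p q ->
    forall k, C1bv_on (psi k) p q;
  lift_fixed : forall v x,
    (exists2 s, s <= x & psi (A_P4_gen v) s = s) /\
    (exists2 t, x <= t & psi (A_P4_gen v) t = t);
  lift_window : forall t0, exists u v : R, [/\ u < v,
    forall g, psi g t0 = t0 -> psi g u = u /\ psi g v = v &
    forall g, psi g t0 = t0 -> (forall x, u <= x <= v -> psi g x = x) -> g = 1%g];
  lift_equivariant : forall g x, pi (psi g x) = phi g (pi x);
  lift_moved : forall v x, psi (A_P4_gen v) x <> x ->
    phi (A_P4_gen v) (pi x) <> pi x;
  lift_right : separates_right phi pi psi;
  lift_left : separates_right phi (pi \o -%R) (mirror psi) }.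

Lemma line_lift_matching (R : realType) (X : topologicalType)
    (phi : A_P4 -> X -> X) (pi : R -> X) (psi : A_P4 -> R -> R) :
  line_lift phi pi psi -> matching phi.
Proof.
move=> [Apsi reg Fpsi Wpsi equi moved sepr sepl].
have Kpsi : kopell_property psi.
  by move=> g h p q x y cg com; apply: (kopell Apsi cg com); exact: reg cg.
have [z fz [H|H]] := bad_points Apsi Kpsi Fpsi Wpsi.
  exact: (matching_right Apsi equi moved sepr fz H).
(* Points accumulating at z from the left accumulate at -z from the right for the mirrored
   action. *)
apply: (matching_right (act_mirror Apsi) (pi := pi \o -%R) (z := - z)) => //.
- by move=> g x /=; rewrite opprK equi.
- by move=> v x nx; apply: moved => /mirror_fixN.
- by move=> g; apply/mirror_fix.
- move=> eps e0; have [[x xz ax] [y yz dy] [t tz bt]] := H eps e0.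
  split; [exists (- x)|exists (- y)|exists (- t)].
  + by move: xz => /andP[]; lra.
  + exact/mirror_fix.
  + by move: yz => /andP[]; lra.
  + exact/mirror_fix.
  + by move: tz => /andP[]; lra.
  + by apply/bad_mirror; rewrite opprK.
Qed.

(** * Connectedness, variation and derivatives *)

Lemma connected_open_split (X : topologicalType) (C U V : set X) (x y : X) :
  connected C -> open U -> open V -> C `<=` U `|` V ->
  C `&` U `&` V `<=` set0 -> C x -> U x -> C y -> V y -> False.
Proof.
move=> conC oU oV CUV dis Cx Ux Cy Vy.
have E : C `&` U = C `&` ~` V.
  apply/seteqP; split=> t [Ct Ut]; split=> //.
    by move=> Vt; apply: (dis t); split.
  by case: (CUV t Ct).
have CE : C `&` U = C.
  apply: conC; first by exists x.
    by exists U.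
  by exists (~` V) => //; exact: open_closedC.
have [_ Uy] : (C `&` U) y by rewrite CE.
by apply: (dis y); split.
Qed.

Lemma bounded_variation_dominated (R : realType) (f : R -> R) (a b : R) :
  a <= b -> bounded_variation a b f ->
  exists T : R -> R, forall x y, a <= x -> x <= y -> y <= b ->
    `|f y - f x| <= T y - T x.
Proof.
move=> ab bv; exists (fun x => fine (total_variation a x f)) => x y ax xy yb.
have fin s t : a <= s -> s <= t -> t <= b -> total_variation s t f \is a fin_num.
  move=> as_ st tb; apply/(bounded_variationP f st).
  apply: (bounded_variationl st tb); apply: (bounded_variationr as_ (le_trans st tb) bv).
have xb := le_trans xy yb.
have <- : fine (total_variation x y f) =
    fine (total_variation a y f) - fine (total_variation a x f).
  by rewrite (total_variationD f ax xy) fineD ?fin // addrC addKr.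
rewrite -lee_fin fineK ?fin //.
exact: total_variation_ge.
Qed.

(** * The interval *)

(** The lower bound of the derivative is its minimum on the compact interval [p, q]. *)
Lemma C1bv_onI (R : realType) (F D : R -> R) (p q : R) : p <= q ->
  continuous D -> (forall x, p <= x <= q -> 0 < D x) ->
  (forall s t, p <= s -> s < t -> t <= q ->
     exists2 xi, s < xi < t & F t - F s = D xi * (t - s)) ->
  (exists T : R -> R, forall x y, p <= x -> x <= y -> y <= q ->
     `|D y - D x| <= T y - T x) ->
  C1bv_on F p q.
Proof.
move=> pq cD D0 mvt [T TD].
have [c cpq mc] := EVT_min pq (continuous_subspaceT cD).
exists D, T, (D c); split=> //.
  by apply: D0; rewrite in_itv in cpq.
move=> eps e0; have /cvgrPdist_lt /(_ eps e0) := cD p.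
case/nbhs_ballP => d d0 Hd; exists d => // x /andP[px xq] xd.
rewrite distrC; apply: Hd; rewrite /ball /= distrC ger0_norm; lra.
Qed.

Lemma frechet_is_derive (R : realType) (F : R -> R) (x d : R) :
  (forall eps, 0 < eps -> exists2 delta, 0 < delta &
     forall y, `|y - x| < delta -> `|F y - F x - d * (y - x)| <= eps * `|y - x|) ->
  is_derive x 1 F d.
Proof.
move=> H.
have L : h^-1 *: (F (h *: 1 + x) - F x) @[h --> 0^'] --> d.
  apply/cvgrPdist_lt => eps e0; have [delta d0 Hd] := H (eps / 2) ltac:(lra).
  near=> h; have h0 : h != 0 by near: h; exact: nbhs_dnbhs_neq.
  have hd : `|h| < delta by near: h; exact: dnbhs0_lt.
  have := Hd (h + x); rewrite addrK => /(_ hd) le.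
  have -> : d - h^-1 *: (F (h *: 1 + x) - F x) = - (h^-1 * (F (h + x) - F x - d * h)).
    by rewrite /GRing.scale /= mulr1; field.
  rewrite normrN normrM normfV; have hp : 0 < `|h| by rewrite normr_gt0.
  by rewrite mulrC ltr_pdivrMr //; apply: le_lt_trans le _; rewrite ltr_pM2r //; lra.
apply: DeriveDef; first by apply/cvg_ex; exists d.
exact: cvg_lim L.
Unshelve. all: by end_near.
Qed.

Section UnitInterval.
Variable R : realType.
Let I := unit_interval R.

Lemma unit_itv_origin_subproof : (0 : R) \in `[0 : R, 1]%classic.
Proof. by rewrite inE /= in_itv /= lexx ler01. Qed.

Definition unit_itv_origin : I := exist _ 0 unit_itv_origin_subproof.

Definition clamp (x : R) : R := Order.max 0 (Order.min 1 x).

(** The retraction of the line onto [0, 1]; after [clamp] the default value of [insubd] never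
    occurs. *)
Definition to_unit_itv (x : R) : I := insubd unit_itv_origin (clamp x).

Lemma clamp_bounds x : 0 <= clamp x <= 1.
Proof. by rewrite le_max lexx ge_max ler01 ge_min lexx. Qed.

Lemma clamp_id x : 0 <= x <= 1 -> clamp x = x.
Proof. by move=> /andP[x0 x1]; rewrite /clamp (min_idPr x1) (max_idPr x0). Qed.

Lemma clamp_dist x y : `|clamp x - clamp y| <= `|x - y|.
Proof.
rewrite /clamp /Order.max /Order.min; do ![case: ifP => //]; move=> *;
  do ?[match goal with H : (_ < _) = false |- _ => move/negbT: H; rewrite -leNgt => H end];
  do [rewrite ler_norml; have := ler_norm (x - y); have := ler_norm (y - x);
      rewrite [`|y - x|]distrC => *; apply/andP; split; lra].
Qed.

Lemma set_val_bounds (y : I) : 0 <= set_val y <= 1.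
Proof. by have /set_mem := valP y; rewrite /= in_itv. Qed.

Lemma to_unit_itvK x : 0 <= x <= 1 -> set_val (to_unit_itv x) = x.
Proof.
move=> x01; rewrite set_valE /to_unit_itv clamp_id // insubdK //.
by rewrite unfold_in /= inE /= in_itv.
Qed.

Lemma set_val_to_unit_itv x : set_val (to_unit_itv x) = clamp x.
Proof.
rewrite set_valE /to_unit_itv insubdK //.
by rewrite unfold_in /= inE /= in_itv /= clamp_bounds.
Qed.

Lemma to_unit_itv_val (y : I) : to_unit_itv (set_val y) = y.
Proof. by apply: val_inj; rewrite -set_valE to_unit_itvK // set_val_bounds. Qed.

Lemma to_unit_itv_continuous : continuous to_unit_itv.
Proof.
apply: (@continuous_comp_initial _ _ _ set_val).
move=> x; apply/cvgrPdist_lt => eps e0; apply/nbhs_ballP; exists eps => // y xy.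
by rewrite /= !set_val_to_unit_itv; apply: le_lt_trans (clamp_dist _ _) xy.
Qed.

Section Extension.
Variables (f : I -> I) (Df : I -> R).
Hypothesis Hf : interval_has_derivative f Df.

Lemma interval_frechet x eps : 0 <= x <= 1 -> 0 < eps ->
  exists2 delta, 0 < delta & forall y, 0 <= y <= 1 -> `|y - x| < delta ->
    `|set_val (f (to_unit_itv y)) - set_val (f (to_unit_itv x)) -
      Df (to_unit_itv x) * (y - x)| <= eps * `|y - x|.
Proof.
move=> x01 e0; pose X := to_unit_itv x.
have /cvgrPdist_lt /(_ eps e0) := Hf (x := X).
rewrite /dnbhs /within /= => -[_ [[W oW <-] /= Wx HW]].
have xE : set_val X = x by rewrite to_unit_itvK.
have : nbhs x W by apply: open_nbhs_nbhs; split=> //; rewrite -xE.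
case/nbhs_ballP => delta d0 Hd; exists delta => // y y01 yx.
have [->|neq] := eqVneq y x; first by rewrite !subrr mulr0 subrr normr0 mulr0.
pose Y := to_unit_itv y; have yE : set_val Y = y by rewrite to_unit_itvK.
have Wy : W (set_val Y) by rewrite yE; apply: Hd; rewrite /ball /= distrC.
have YX : Y != X by apply: contraNneq neq => YX; rewrite -yE -xE YX.
have := HW Y Wy YX; rewrite yE xE -/X -/Y => lt.
have yx0 : y - x != 0 by rewrite subr_eq0.
have -> : set_val (f Y) - set_val (f X) - Df X * (y - x) =
    - (Df X - (set_val (f Y) - set_val (f X)) / (y - x)) * (y - x) by field.
by rewrite normrM normrN; apply: ler_wpM2r => //; exact: ltW.
Qed.

End Extension.

(** Two linear approximations are compared at a nearby point of [0, 1]. This identifies the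
    continuous derivative with the one of bounded variation, which [Diff1bv] supplies separately. *)
Lemma interval_derivative_unique (f : I -> I) (D1 D2 : I -> R) x :
  interval_has_derivative f D1 -> interval_has_derivative f D2 -> 0 <= x <= 1 ->
  D1 (to_unit_itv x) = D2 (to_unit_itv x).
Proof.
move=> H1 H2 x01; apply/eqP; rewrite -subr_eq0 -normr_eq0.
rewrite eq_le normr_ge0 andbT; apply/ler_addgt0Pl => eps e0; rewrite addr0.
have [d1 d10 h1] := interval_frechet H1 (eps := eps / 2) x01 ltac:(lra).
have [d2 d20 h2] := interval_frechet H2 (eps := eps / 2) x01 ltac:(lra).
(* With d <= 1/2, one of x + d and x - d stays in [0, 1]. *)
pose d := Order.min (1 / 2) (Order.min (d1 / 2) (d2 / 2)).
have d0 : 0 < d by rewrite !lt_min; apply/andP; split; [lra|apply/andP; split; lra].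
have [dh [dd1 dd2]] : d <= 1 / 2 /\ d <= d1 / 2 /\ d <= d2 / 2.
  by rewrite !ge_min !lexx !orbT.
have [y [y01 yx]] : exists y, 0 <= y <= 1 /\ `|y - x| = d.
  have /andP[x0 x1] := x01; have [le|lt] := leP x (1 / 2).
    exists (x + d); have -> : x + d - x = d by ring.
    by rewrite gtr0_norm //; split=> //; apply/andP; split; lra.
  exists (x - d); have -> : x - d - x = - d by ring.
  by rewrite normrN gtr0_norm //; split=> //; apply/andP; split; lra.
have := h1 y y01; have := h2 y y01; rewrite yx => /(_ ltac:(lra)) l2 /(_ ltac:(lra)) l1.
rewrite -(ler_pM2r d0) -{1}yx -normrM.
set A := set_val _ - set_val _ in l1 l2.
have -> : (D1 (to_unit_itv x) - D2 (to_unit_itv x)) * (y - x) =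
  (A - D2 (to_unit_itv x) * (y - x)) - (A - D1 (to_unit_itv x) * (y - x)) by ring.
by apply: le_trans (ler_normB _ _) _; lra.
Qed.

Section IntervalDiffeo.
Variable f : I -> I.
Hypothesis f_diff : @Diff1bv R Closed_interval f.

Lemma interval_data : exists D : R -> R,
  [/\ continuous D, forall x, 0 <= x <= 1 -> 0 < D x,
      forall x eps, 0 <= x <= 1 -> 0 < eps ->
        exists2 delta, 0 < delta & forall y, 0 <= y <= 1 -> `|y - x| < delta ->
        `|set_val (f (to_unit_itv y)) - set_val (f (to_unit_itv x)) -
          D x * (y - x)| <= eps * `|y - x| &
      exists T : R -> R, forall x y, 0 <= x -> x <= y -> y <= 1 ->
        `|D y - D x| <= T y - T x].
Proof.
case: f_diff => -[[D1 hD1 cD1] _] [D2 [hD2 D2pos bv]].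
exists (D1 \o to_unit_itv); split.
- by move=> x; apply: continuous_comp; [exact: to_unit_itv_continuous|exact: cD1].
- by move=> x x01 /=; rewrite (interval_derivative_unique hD1 hD2 x01).
- by move=> x eps x01 e0; exact: (interval_frechet hD1 x01 e0).
have [T HT] := bounded_variation_dominated ler01 bv; exists T => x y x0 xy y1.
have E z : 0 <= z <= 1 -> (D1 \o to_unit_itv) z = 'valL_ 0 D2 z.
  move=> z01 /=; rewrite (interval_derivative_unique hD1 hD2 z01).
  rewrite -{2}(to_unit_itvK z01); have := @sigL_valL R R 0 `[0, 1]%classic.
  by move=> /(congr1 (fun g => g D2 (to_unit_itv z))) /= <-.
rewrite !E; [exact: HT|lra|lra].
Qed.

End IntervalDiffeo.

End UnitInterval.

(** The map [phi 1] is idempotent and injective. *)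
Lemma diffeo_hom1 (R : realType) (M : one_manifold)
    (phi : A_P4 -> carrier R M -> carrier R M) :
  (forall g, Diff1bv (phi g)) ->
  (forall g h, phi (g * h)%g = phi g \o phi h) -> phi 1%g = id.
Proof.
move=> phi_Diff phi_hom; have [[_ [g [fg _ _]]] _] := phi_Diff 1%g.
apply/funext => x; apply: (can_inj fg).
by have := phi_hom 1%g 1%g; rewrite mulg1 => /(congr1 (fun u => u x)) /= <-.
Qed.

Section IntervalLift.
Variable R : realType.
Let I := unit_interval R.
Notation to_I := (@to_unit_itv R).

Definition interval_lift (f : I -> I) (x : R) : R :=
  if 0 <= x <= 1 then set_val (f (to_I x)) else x.

Lemma interval_liftE f x : 0 <= x <= 1 ->
  interval_lift f x = set_val (f (to_I x)).
Proof. by rewrite /interval_lift => ->. Qed.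

Lemma interval_lift_bounds f x : (0 <= interval_lift f x <= 1) = (0 <= x <= 1).
Proof.
rewrite /interval_lift; have [x01|//] := boolP (0 <= x <= 1).
  by rewrite set_val_bounds.
by move=> nx; rewrite (negbTE nx).
Qed.

Lemma interval_lift_comp f g x :
  interval_lift (f \o g) x = interval_lift f (interval_lift g x).
Proof.
have [x01|nx] := boolP (0 <= x <= 1); last first.
  by rewrite /interval_lift (negbTE nx) (negbTE nx).
rewrite [LHS]interval_liftE // [RHS]interval_liftE ?interval_lift_bounds //.
by rewrite [interval_lift g x]interval_liftE // to_unit_itv_val.
Qed.

Section Diffeo.
Variable f : I -> I.
Hypothesis f_diff : @Diff1bv R Closed_interval f.

Lemma interval_lift_C1bv p q : 0 <= p -> p < q -> q <= 1 ->
  C1bv_on (interval_lift f) p q.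
Proof.
move=> p0 pq q1; have [D [cD D0 frechet [T HT]]] := interval_data f_diff.
pose G x := set_val (f (to_I x)).
have clampE x : to_I (clamp x) = to_I x.
  by rewrite -[RHS]to_unit_itv_val set_val_to_unit_itv.
have cG : continuous G.
  move=> x; have cx := clamp_bounds x.
  have [delta d0 Hd] := frechet (clamp x) 1 cx ltr01.
  apply/cvgrPdist_lt => eps e0; apply/nbhs_ballP.
  (* A local Lipschitz constant at x, from the first-order estimate with error 1. *)
  pose K := 1 + `|D (clamp x)|; have K0 : 0 < K by rewrite ltr_pwDl.
  exists (Order.min delta (eps / K)); first by rewrite /= lt_min d0 divr_gt0.
  move=> y; rewrite /ball /= lt_min => /andP[yd ye].
  have dist := clamp_dist y x; rewrite [`|y - x|]distrC in dist.
  have := Hd (clamp y) (clamp_bounds y) (le_lt_trans dist yd).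
  rewrite !clampE mul1r -/(G y) -/(G x) => le; rewrite distrC.
  have : `|G y - G x| <= K * `|clamp y - clamp x|.
    rewrite /K mulrDl mul1r -normrM.
    have -> : G y - G x = (G y - G x - D (clamp x) * (clamp y - clamp x)) +
      D (clamp x) * (clamp y - clamp x) by ring.
    by apply: le_trans (ler_normD _ _) _; rewrite lerD2r.
  move=> /le_lt_trans; apply.
  rewrite mulrC -ltr_pdivlMr //; exact: le_lt_trans dist ye.
apply: (C1bv_onI (D := D)) => //; first exact: ltW.
- by move=> x /andP[px xq]; apply: D0; apply/andP; split; lra.
- move=> s t ps st tq.
  have [||xi xist E] := @MVT R G D s t st.
  + move=> x; rewrite in_itv /= => /andP[sx xt]; apply: frechet_is_derive => eps e0.
    have [|delta d0 Hd] := frechet x eps _ e0; first by apply/andP; split; lra.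
    (* The bounds x and 1 - x keep y in [0, 1], so the derivative at the interior point x is
       two-sided. *)
    exists (Order.min delta (Order.min x (1 - x))).
      by rewrite !lt_min d0; apply/andP; split; lra.
    move=> y; rewrite !lt_min => /andP[yd /andP[]]; rewrite !ltr_norml => /andP[y1 y2] /andP[y3 y4].
    by apply: Hd => //; apply/andP; split; lra.
  + exact: continuous_subspaceT.
  exists xi; first by move: xist; rewrite in_itv.
  by rewrite !interval_liftE //; apply/andP; split; lra.
- by exists T => x y px xy yq; apply: HT; lra.
Qed.

Lemma interval_lift_homo01 : {in `[0, 1] &, {homo interval_lift f : x y / x < y}}.
Proof.
have [D [_ [m [m0 mD mvt _ _]]]] := interval_lift_C1bv (lexx 0) ltr01 (lexx 1).
move=> x y; rewrite !in_itv /= => /andP[x0 x1] /andP[y0 y1] xy.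
have [xi /andP[xi1 xi2] E] := mvt x y x0 xy y1.
rewrite -subr_gt0 E mulr_gt0 ?subr_gt0 //.
by apply: lt_le_trans m0 _; apply: mD; apply/andP; split; lra.
Qed.

Hypothesis f_surj : forall y, exists x, f x = y.

(** Some x in [0, 1] is sent to 0 by surjectivity, and monotonicity puts the image of 0 below it. *)
Lemma interval_lift0 : interval_lift f 0 = 0.
Proof.
have [X fX] := f_surj (to_I 0); pose x := set_val X.
have /andP[x0 x1] := set_val_bounds X.
have fx : interval_lift f x = 0.
  by rewrite interval_liftE ?x0 // to_unit_itv_val fX to_unit_itvK // lexx ler01.
have /andP[f0 _] : 0 <= interval_lift f 0 <= 1 by rewrite interval_lift_bounds lexx ler01.
apply/eqP; rewrite eq_le f0 andbT; have [xp|xn] := ltP 0 x.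
  by rewrite -{2}fx ltW // interval_lift_homo01 // in_itv /= ?lexx ?ler01 // x1 ltW.
by have <- : x = 0; [apply/eqP; rewrite eq_le xn x0|rewrite fx].
Qed.

Lemma interval_lift1 : interval_lift f 1 = 1.
Proof.
have [X fX] := f_surj (to_I 1); pose x := set_val X.
have /andP[x0 x1] := set_val_bounds X.
have fx : interval_lift f x = 1.
  by rewrite interval_liftE ?x0 // to_unit_itv_val fX to_unit_itvK // lexx ler01.
have /andP[_ f1] : 0 <= interval_lift f 1 <= 1 by rewrite interval_lift_bounds lexx ler01.
apply/eqP; rewrite eq_le f1 /=; have [xp|xn] := ltP x 1.
  by rewrite -{1}fx ltW // interval_lift_homo01 // in_itv /= ?lexx ?ler01 // x0 ltW.
by have <- : x = 1; [apply/eqP; rewrite eq_le xn x1|rewrite fx].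
Qed.

Lemma interval_lift_homo : {homo interval_lift f : x y / x < y}.
Proof.
have out x : x < 0 \/ 1 < x -> interval_lift f x = x.
  rewrite /interval_lift => -[lt|lt]; case: ifP => // /andP[]; lra.
have low x : 0 <= x -> 0 <= interval_lift f x.
  move=> x0; have [x1|lt] := leP x 1; last by rewrite out //; right.
  by have /andP[] : 0 <= interval_lift f x <= 1 by rewrite interval_lift_bounds x0.
have high x : x <= 1 -> interval_lift f x <= 1.
  move=> x1; have [x0|lt] := leP 0 x; last by rewrite out //; left.
  by have /andP[] : 0 <= interval_lift f x <= 1 by rewrite interval_lift_bounds x0.
move=> x y xy; have [x0|x0] := ltP x 0.
  rewrite out; last by left.
  have [y0|y0] := ltP y 0; first by rewrite out //; left.
  exact: lt_le_trans x0 (low y y0).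
have [y1|y1] := ltP 1 y.
  rewrite [X in _ < X]out; last by right.
  have [x1|x1] := ltP 1 x; first by rewrite out //; right.
  exact: le_lt_trans (high x x1) y1.
by apply: interval_lift_homo01 => //; rewrite in_itv /=; apply/andP; split; lra.
Qed.

End Diffeo.

Variable phi : A_P4 -> I -> I.
Hypotheses (phi_Diff : forall g, @Diff1bv R Closed_interval (phi g))
  (phi_hom : forall g h, phi (g * h)%g = phi g \o phi h)
  (phi_inj : injective phi).

Let psi (g : A_P4) : R -> R := interval_lift (phi g).

(** A connected subset of the support cannot cross the fixed point x. *)
Lemma interval_components_differ v s x t : s < x -> x < t ->
  psi (A_P4_gen v) x = x -> psi (A_P4_gen v) s <> s -> psi (A_P4_gen v) t <> t ->
  component phi v (to_I s) <> component phi v (to_I t).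
Proof.
move=> sx xt vx vs vt e.
have in01 y : psi (A_P4_gen v) y <> y -> 0 <= y <= 1.
  by rewrite /psi /interval_lift; case: ifP.
have /andP[s0 s1] := in01 s vs; have /andP[t0 t1] := in01 t vt.
have moved y : 0 <= y <= 1 -> psi (A_P4_gen v) y <> y ->
    supp (phi (A_P4_gen v)) (to_I y).
  move=> y01 vy fy; apply: vy; rewrite /psi interval_liftE //.
  by rewrite fy to_unit_itvK.
have ov : continuous (set_val : I -> R) by exact: initial_continuous.
pose C := component phi v (to_I s).
apply: (@connected_open_split I C [set y | set_val y < x] [set y | x < set_val y]
   (to_I s) (to_I t)).
- exact: component_connected.
- apply: (@open_comp _ _ set_val [set y | y < x]); first by move=> y _; exact: ov.
  exact: open_lt.
- apply: (@open_comp _ _ set_val [set y | x < y]); first by move=> y _; exact: ov.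
  exact: open_gt.
- move=> y Cy; have vy := connected_component_sub Cy.
  have [lt|lt|yx] := ltgtP (set_val y) x; [by left|by right|].
  case: vy; rewrite /Fix /=; apply: val_inj; rewrite -set_valE yx.
  by rewrite -vx /psi interval_liftE -?yx ?set_val_bounds // to_unit_itv_val.
- by move=> y [[_ /= lt]] /(lt_trans lt); rewrite ltxx.
- by apply: connected_component_refl; apply: moved; rewrite ?s0.
- by rewrite /= to_unit_itvK ?s0.
- by rewrite /C e; apply: connected_component_refl; apply: moved; rewrite ?t0.
- by rewrite /= to_unit_itvK ?t0.
Qed.

Lemma interval_line_lift : line_lift phi to_I psi.
Proof.
have surj g y : exists x, phi g x = y.
  exists (phi g^-1%g y).
  by have := phi_hom g g^-1%g; rewrite mulgV (diffeo_hom1 phi_Diff phi_hom) => /(congr1 (fun u => u y)) /= <-.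
have fix0 g : psi g 0 = 0 by apply: interval_lift0 => //; exact: surj.
have fix1 g : psi g 1 = 1 by apply: interval_lift1 => //; exact: surj.
have out g x : ~~ (0 <= x <= 1) -> psi g x = x.
  by rewrite /psi /interval_lift => /negbTE ->.
have A : line_action psi.
  split=> [g h x|x|g x y xy].
  - by rewrite /psi phi_hom interval_lift_comp.
  - rewrite /psi (diffeo_hom1 phi_Diff phi_hom) /interval_lift; case: ifP => // x01.
    exact: to_unit_itvK.
  - by apply: interval_lift_homo => //; exact: surj.
split=> //.
- move=> g p q [pq gp gq free] k; apply: interval_lift_C1bv => //.
    (* If p < 0, the interval (p, q) contains negative points, which are all fixed. *)
    rewrite leNgt; apply/negP => p0; pose r := Order.min 0 q.
    have [r0 rq] : r <= 0 /\ r <= q by rewrite !ge_min !lexx orbT.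
    have pr : p < r by rewrite lt_min p0.
    apply: (free ((p + r) / 2)); first by apply/andP; split; lra.
    by apply: out; rewrite negb_and -!ltNge; apply/orP; left; lra.
  rewrite leNgt; apply/negP => q1; pose r := Order.max 1 p.
  have [r0 rq] : 1 <= r /\ p <= r by rewrite !le_max !lexx orbT.
  have pr : r < q by rewrite gt_max q1.
  apply: (free ((q + r) / 2)); first by apply/andP; split; lra.
  by apply: out; rewrite negb_and -!ltNge; apply/orP; right; lra.
- move=> v x; split.
    have [lt|le] := ltP x 0; last by exists 0.
    by exists x => //; apply: out; rewrite negb_and -!ltNge lt.
  have [lt|le] := ltP 1 x; last by exists 1.
  by exists x => //; apply: out; rewrite negb_and -!ltNge lt orbT.
- move=> t0; exists 0, 1; split=> // g _ H; apply: phi_inj; rewrite (diffeo_hom1 phi_Diff phi_hom).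
  apply/funext => y; apply: val_inj; have := H _ (set_val_bounds y).
  by rewrite /psi interval_liftE ?set_val_bounds // to_unit_itv_val.
- move=> g x; have [x01|nx] := boolP (0 <= x <= 1).
    by rewrite /psi interval_liftE // to_unit_itv_val.
  rewrite out //.
  (* A point outside [0, 1] retracts to an end point, which is fixed by every [phi g]. *)
  have fixI z : 0 <= z <= 1 -> psi g z = z -> phi g (to_I z) = to_I z.
    move=> z01; rewrite /psi interval_liftE // => e.
    by apply: val_inj; rewrite -!set_valE e to_unit_itvK.
  have clampE : to_I (clamp x) = to_I x.
    by rewrite -[RHS]to_unit_itv_val set_val_to_unit_itv.
  rewrite -clampE fixI ?clamp_bounds //.
  have [lt|le] := ltP x 0.
    suff -> : clamp x = 0 by [].
    by rewrite /clamp /Order.max /Order.min; case: ifP; case: ifP; lra.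
  suff -> : clamp x = 1 by [].
  have x1 : 1 < x by move: nx; rewrite le /= -ltNge.
  by rewrite /clamp /Order.max /Order.min x1 ltr01.
- move=> v x vx e; apply: vx; rewrite /psi /interval_lift; case: ifP => // x01.
  by rewrite e to_unit_itvK.
- by move=> v z s x t _ vx vs vt _ sx xt _; exact: interval_components_differ vx vs vt.
- move=> v z s x t _ /mirror_fixN vx vs vt _ sx xt _ /= e.
  apply: (@interval_components_differ v (- t) (- x) (- s)) => //.
  + by rewrite ltrN2.
  + by rewrite ltrN2.
  + by move=> /mirror_fixN.
  + by move=> /mirror_fixN.
Qed.

End IntervalLift.

(** * The circle *)

Lemma int_lt1_eq0 (R : realType) (k : int) : `|k%:~R : R| < 1 -> k = 0.
Proof.
rewrite -intr_norm -[1]/(1%:~R) ltr_int => k1.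
by apply/eqP; rewrite -normr_eq0 eq_le normr_ge0 andbT -ltzD1.
Qed.

(** Two distinct integer values would force the value m + 1/2 in between. *)
Lemma int_valued_continuous_constant (R : realType) (h : R -> R) :
  continuous h -> (forall t, exists k : int, h t = k%:~R) ->
  forall s t, h s = h t.
Proof.
move=> ch hint.
suff H s t : s <= t -> h s = h t.
  by move=> s t; have [/H//|/ltW/H] := leP s t.
move=> st; have [k hk] := hint s; have [l hl] := hint t.
have [kl|kl] := eqVneq k l; first by rewrite hk hl kl.
pose m := Order.min k l; pose M := Order.max k l.
have mM : m + 1 <= M.
  by rewrite /m /M; case: (ltgtP k l) kl => //; rewrite lezD1.
have mMR : (m%:~R + 1 <= M%:~R :> R) by rewrite -[1]/(1%:~R) -intrD ler_int.
have [||c cst hc] := @IVT R h s t (m%:~R + 1 / 2) st.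
- exact: continuous_subspaceT.
- have -> : Order.min (h s) (h t) = m%:~R.
    rewrite hk hl /m; case: (leP k l) => le.
      by rewrite min_l // ler_int.
    by rewrite min_r // ler_int ltW.
  have -> : Order.max (h s) (h t) = M%:~R.
    rewrite hk hl /M; case: (leP k l) => le.
      by rewrite max_r // ler_int.
    by rewrite max_l // ler_int ltW.
  by apply/andP; split; lra.
have [n hn] := hint c; move: hc; rewrite hn => /eqP; rewrite addrC -subr_eq -intrB => /eqP e.
have n0 : n - m = 0 by apply: (@int_lt1_eq0 R); rewrite e gtr0_norm; lra.
by move: e; rewrite n0; lra.
Qed.

Section Periodic.
Variables (R : realType) (F : R -> R).
Hypothesis F1 : forall t, F (t + 1) = F t + 1.

Lemma periodic_int t (k : int) : F (t + k%:~R) = F t + k%:~R.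
Proof.
have nat n : forall t, F (t + n%:R) = F t + n%:R.
  elim: n => [|n IH] s; first by rewrite !addr0.
  by rewrite -natr1 addrA F1 IH addrA.
case: k => n; first exact: nat.
by rewrite NegzE mulrNz; apply: (addIr n.+1%:R); rewrite -nat !subrK.
Qed.

End Periodic.

Section Circle.
Variable R : realType.
Let S := circle R.
Notation proj := (@circle_proj R).

Lemma circle_projP s t : proj s = proj t <-> exists k : int, s = t + k%:~R.
Proof.
have E : (s - t \in integers R) <-> (proj s = proj t).
  have projE u : proj u = (\pi_{ideal_quot integers R} u)%qT.
    by rewrite /circle_proj !unlock.
  by rewrite Quotient.idealrBE !projE; split=> [/eqP ->|e]; last exact/eqP.
rewrite -E; split=> [/Num.int_num_subproof [k e]|[k ->]].
  by exists k; rewrite -e addrC subrK.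
rewrite addrC addKr.
by apply/Num.int_num_subproof; exists k.
Qed.

Lemma circle_proj_surj y : exists t, proj t = y.
Proof. by exists (generic_quotient.repr y); rewrite /circle_proj reprK. Qed.

Definition circle_lift (f : S -> S) (F : R -> R) : Prop :=
  continuous F /\ forall t, proj (F t) = f (proj t).

(** The difference of two lifts is continuous and integer valued. *)
Lemma circle_lift_unique f F1 F2 : circle_lift f F1 -> circle_lift f F2 ->
  exists k : int, forall t, F1 t = F2 t + k%:~R.
Proof.
move=> [c1 l1] [c2 l2].
have hint t : exists k : int, F1 t - F2 t = k%:~R.
  have /circle_projP [k ->] : proj (F1 t) = proj (F2 t) by rewrite l1 l2.
  by exists k; rewrite addrC addKr.
have cd : continuous (fun t => F1 t - F2 t).
  by move=> t; apply: continuousB; [exact: c1|exact: c2].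
have [k hk] := hint 0; exists k => t.
by rewrite -hk -(int_valued_continuous_constant cd hint t 0) addrC subrK.
Qed.

Lemma circle_lift_eq f F1 F2 s : circle_lift f F1 -> circle_lift f F2 ->
  F1 s = F2 s -> F1 = F2.
Proof.
move=> l1 l2 e; have [k hk] := circle_lift_unique l1 l2.
have k0 : k%:~R = 0 :> R by apply: (addrI (F2 s)); rewrite -hk e addr0.
by apply/funext => t; rewrite hk k0 addr0.
Qed.

Lemma circle_lift_comp f g F G : circle_lift f F -> circle_lift g G ->
  circle_lift (f \o g) (F \o G).
Proof.
move=> [cF lF] [cG lG]; split=> [t|t /=]; last by rewrite lF lG.
by apply: continuous_comp; [exact: cG|exact: cF].
Qed.

Lemma circle_lift_shift f F (c : int) : circle_lift f F ->
  circle_lift f (fun t => F t - c%:~R).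
Proof.
move=> [cF lF]; split=> t; first by apply: continuousB; [exact: cF|exact: cst_continuous].
rewrite -lF; apply/circle_projP; exists (- c).
by rewrite mulrNz.
Qed.

Lemma circle_lift_id : circle_lift id id.
Proof. by split=> // t; exact: cvg_id. Qed.

Section CircleDiffeo.
Variable f : S -> S.
Hypothesis f_diff : @Diff1bv R Circle_S1 f.

(** The lifts behind the two derivatives given by [Diff1bv] differ by an integer constant, so the
    derivatives agree. *)
Lemma circle_data : exists F D : R -> R,
  [/\ circle_lift f F, forall t : R, is_derive t 1 F (D t), continuous D,
      forall t, 0 < D t & (forall t, D (t + 1) = D t) /\
      exists T : R -> R, forall x y, 0 <= x -> x <= y -> y <= 1 ->
        `|D y - D x| <= T y - T x].
Proof.
case: f_diff => -[[D1 [F1 lF1 dF1] cD1] _] [D2 [[F2 lF2 dF2] D2pos bv]].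
have cont (F D : R -> R) : (forall t : R, is_derive t 1 F (D t)) -> continuous F.
  move=> dF t; apply/differentiable_continuous/derivable1_diffP.
  by have [] := dF t.
have l1 : circle_lift f F1 by split=> //; exact: cont dF1.
have l2 : circle_lift f F2 by split=> //; exact: cont dF2.
have [k hk] := circle_lift_unique l1 l2.
have F1E : F1 = F2 \+ cst k%:~R by apply/funext.
have D12 t : D1 (proj t) = D2 (proj t).
  have d2 : is_derive t 1 F1 (D2 (proj t) + 0).
    by rewrite F1E; apply: is_deriveD.
  by rewrite -[LHS](@derive_val _ _ _ _ _ _ _ (dF1 t)) derive_val addr0.
exists F1, (D1 \o proj); split=> //.
- by move=> t; apply: continuous_comp; [exact: pi_continuous|exact: cD1].
- by move=> t /=; rewrite D12.
split=> [t /=|].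
  by congr D1; apply/circle_projP; exists 1.
have [T HT] := bounded_variation_dominated ler01 bv; exists T => x y x0 xy y1.
by have := HT x y x0 xy y1; rewrite /= !D12.
Qed.

Lemma circle_lift_C1bv F p q : circle_lift f F -> p < q -> q <= p + 1 ->
  C1bv_on F p q.
Proof.
move=> lF pq qp; have [F0 [D [lF0 dF0 cD D0 [Dper [T HT]]]]] := circle_data.
have [k hk] := circle_lift_unique lF lF0.
have Dint t (m : int) : D (t - m%:~R) = D t.
  have nat n : forall t, D (t + n%:R) = D t.
    elim: n => [|n IH] s; first by rewrite addr0.
    by rewrite -natr1 addrA Dper.
  case: m => n; first by rewrite -[LHS](nat n) subrK.
  by rewrite NegzE mulrNz opprK nat.
apply: (C1bv_onI (D := D)) => //; first exact: ltW.
  move=> s t ps st tq.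
  have cF0 : {within `[s, t], continuous F0}.
    by apply: continuous_subspaceT; case: lF0.
  have [xi xist E] := MVT st (fun x _ => dF0 x) cF0.
  exists xi; first by move: xist; rewrite in_itv.
  by rewrite !hk -E; ring.
pose n := Num.floor p; have np : n%:~R <= p by exact: floor_le.
have pn : p < n%:~R + 1 by rewrite -intrD1 floorD1_gt.
have DE t : D t = D (t - n%:~R) by rewrite Dint.
have DE1 t : D t = D (t - n%:~R - 1) by rewrite -(Dper (_ - 1)) subrK Dint.
(* The interval [p, q] meets at most the periods starting at n and n + 1. The variation function is
   copied on each, normalized to vanish at n + 1 from both sides. *)
exists (fun x => if x < n%:~R + 1 then T (x - n%:~R) - T 1 else T (x - n%:~R - 1) - T 0).
move=> x y px xy yq; have [yn|yn] := ltP y (n%:~R + 1).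
  rewrite ifT; last lra.
  rewrite DE [D x]DE; have := HT (x - n%:~R) (y - n%:~R) ltac:(lra) ltac:(lra) ltac:(lra).
  lra.
have [xn|xn] := ltP x (n%:~R + 1).
  have h1 := HT (x - n%:~R) 1 ltac:(lra) ltac:(lra) ltac:(lra).
  have h2 := HT 0 (y - n%:~R - 1) ltac:(lra) ltac:(lra) ltac:(lra).
  have D01 : D 0 = D 1 by rewrite -(Dper 0) add0r.
  rewrite DE1 [D x]DE.
  have -> : D (y - n%:~R - 1) - D (x - n%:~R) =
    (D (y - n%:~R - 1) - D 0) + (D 1 - D (x - n%:~R)) by rewrite D01; ring.
  by apply: le_trans (ler_normD _ _) _; lra.
rewrite DE1 [D x]DE1.
have := HT (x - n%:~R - 1) (y - n%:~R - 1) ltac:(lra) ltac:(lra) ltac:(lra).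
lra.
Qed.

Lemma circle_lift_homo F : circle_lift f F -> {homo F : x y / x < y}.
Proof.
move=> lF x y xy; have [F0 [D [lF0 dF0 _ D0 _]]] := circle_data.
have [k hk] := circle_lift_unique lF lF0; rewrite !hk ltrD2r.
have cF0 : {within `[x, y], continuous F0}.
  by apply: continuous_subspaceT; case: lF0.
have [xi _ E] := MVT xy (fun x _ => dF0 x) cF0.
by rewrite -subr_gt0 E mulr_gt0 // subr_gt0.
Qed.

Lemma circle_lift_through s t : f (proj s) = proj t ->
  exists2 F, circle_lift f F & F s = t.
Proof.
move=> fs; have [F [_ [lF _ _ _ _]]] := circle_data.
have /circle_projP [k e] : proj (F s) = proj t by case: lF => _ ->.
by exists (fun t => F t - k%:~R); [exact: circle_lift_shift|rewrite e addrK].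
Qed.

End CircleDiffeo.

End Circle.

(** The points s + m with m an integer are fixed, so each interval [s + m, s + m + 1) is
    preserved. *)
Lemma periodic_homo_near (R : realType) (F : R -> R) (s y : R) :
  {homo F : x y / x < y} -> (forall t, F (t + 1) = F t + 1) -> F s = s ->
  `|F y - y| < 1.
Proof.
move=> homoF F1 Fs; pose m := Num.floor (y - s).
have m1 : m%:~R <= y - s by exact: floor_le.
have m2 : y - s < m%:~R + 1 by rewrite -intrD1 floorD1_gt.
have Fm : F (s + m%:~R) = s + m%:~R by rewrite (periodic_int F1) Fs.
have Fm1 : F (s + m%:~R + 1) = s + m%:~R + 1 by rewrite F1 Fm.
have lt : F y < s + m%:~R + 1 by rewrite -Fm1; apply: homoF; lra.
have le : s + m%:~R <= F y.
  rewrite -Fm; have [->//|neq] := eqVneq (s + m%:~R) y.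
  by rewrite ltW // homoF // lt_neqAle neq; lra.
by rewrite ltr_norml; apply/andP; split; lra.
Qed.

Section CircleLift.
Variable R : realType.
Let S := circle R.
Notation proj := (@circle_proj R).
Variable phi : A_P4 -> S -> S.
Hypotheses (phi_Diff : forall g, @Diff1bv R Circle_S1 (phi g))
  (phi_hom : forall g h, phi (g * h)%g = phi g \o phi h)
  (phi_inj : injective phi)
  (phi_fix : forall v, Fix (phi (A_P4_gen v)) !=set0).

Let phi1 : phi 1%g = id := diffeo_hom1 phi_Diff phi_hom.

Let phiV g x : phi g x = x -> phi g^-1%g x = x.
Proof.
move=> gx; have := phi_hom g^-1%g g; rewrite mulVg phi1.
by move=> /(congr1 (fun u => u x)) /=; rewrite gx.
Qed.

(** The preimage of the image of A is the union of its integer translates. *)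
Lemma circle_open_proj (A : set R) : open A -> open (proj @` A).
Proof.
move=> oA; suff E : proj @^-1` (proj @` A) =
    \bigcup_(k in [set: int]) (fun x : R => x + k%:~R) @^-1` A.
  rewrite /open /= /quotient_open -/(circle_proj _).
  rewrite [X in open X]E.
  apply: bigcup_open => k _; apply: open_comp => // x _.
  by apply: continuousD; [exact: cvg_id|exact: cst_continuous].
apply/seteqP; split=> x /=.
  by move=> [y Ay /circle_projP [k yE]]; exists k => //=; rewrite -yE.
by move=> [k _ Ak]; exists (x + k%:~R) => //; apply/circle_projP; exists k.
Qed.

(** The fixed points z and x cut the circle into the arcs (z, x) and (x, z + 1), one containing s
    and the other t. *)
Lemma circle_components_differ (psi : A_P4 -> R -> R) v z s x t :
  (forall g x, proj (psi g x) = phi g (proj x)) ->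
  (forall x, psi (A_P4_gen v) x <> x ->
     phi (A_P4_gen v) (proj x) <> proj x) ->
  psi (A_P4_gen v) z = z -> psi (A_P4_gen v) x = x ->
  psi (A_P4_gen v) s <> s -> psi (A_P4_gen v) t <> t ->
  z < s -> s < x -> x < t -> t < z + 1 ->
  component phi v (proj s) <> component phi v (proj t).
Proof.
move=> equi moved vz vx vs vt zs sx xt tz e.
pose C := component phi v (proj s).
have same y y' : proj y = proj y' -> `|y - y'| < 1 -> y = y'.
  move=> /circle_projP [k ->]; rewrite addrC addKr => /int_lt1_eq0 ->.
  by rewrite addr0.
apply: (@connected_open_split S C (proj @` `]z, x[) (proj @` `]x, z + 1[)
   (proj s) (proj t)).
- exact: component_connected.
- by apply: circle_open_proj; exact: interval_open.
- by apply: circle_open_proj; exact: interval_open.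
- move=> Y CY; have vY := connected_component_sub CY.
  have [y0 y0Y] := circle_proj_surj Y.
  pose m := Num.floor (y0 - z); pose y := y0 - m%:~R.
  have m1 : m%:~R <= y0 - z by exact: floor_le.
  have m2 : y0 - z < m%:~R + 1 by rewrite -intrD1 floorD1_gt.
  have yY : proj y = Y.
    rewrite -y0Y; apply/circle_projP; exists (- m); by rewrite mulrNz.
  have nfix w : psi (A_P4_gen v) w = w -> y <> w.
    by move=> vw yw; apply: vY; rewrite /Fix /= -yY yw -equi vw.
  have yz : y != z by apply/eqP; exact: nfix.
  have yx : y != x by apply/eqP; exact: nfix.
  have [lt|lt|e'] := ltgtP y x; last by rewrite e' eqxx in yx.
    left; exists y => //=; rewrite in_itv /= lt andbT lt_neqAle eq_sym yz /=.
    by rewrite /y; lra.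
  by right; exists y => //=; rewrite in_itv /= lt /= /y; lra.
- move=> Y [[_ /= [y +  yY]] [y' + y'Y]]; rewrite /= !in_itv /= => /andP[y1 y2] /andP[y3 y4].
  have yy' : y = y' by apply: same; [rewrite yY|rewrite ltr_norml; apply/andP; split; lra].
  by move: y2; rewrite yy' ltNge (ltW y3).
- by apply: connected_component_refl; exact: moved.
- by exists s => //=; rewrite in_itv /= zs.
- by rewrite /C e; apply: connected_component_refl; exact: moved.
- by exists t => //=; rewrite in_itv /= xt.
Qed.

Lemma circle_letter_lifts : exists (t : P4_vertex -> R) (L : P4_vertex -> bool -> R -> R),
  forall v s, circle_lift (phi (if s then A_P4_gen v else (A_P4_gen v)^-1%g)) (L v s) /\
    L v s (t v) = t v.
Proof.
have ext v : exists t, phi (A_P4_gen v) (proj t) = proj t.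
  by have [x vx] := phi_fix v; have [t tx] := circle_proj_surj x; exists t; rewrite tx.
have [t ht] := choice ext.
have exL (vs : P4_vertex * bool) : exists F,
    circle_lift (phi (if vs.2 then A_P4_gen vs.1 else (A_P4_gen vs.1)^-1%g)) F /\
    F (t vs.1) = t vs.1.
  have fixed : phi (if vs.2 then A_P4_gen vs.1 else (A_P4_gen vs.1)^-1%g) (proj (t vs.1)) =
      proj (t vs.1) by case: vs.2; [exact: ht|apply: phiV; exact: ht].
  by have [F lF Ft] := circle_lift_through (phi_Diff _) fixed; exists F.
have [L HL] := choice exL.
by exists t, (fun v s => L (v, s)) => v s; exact: HL (v, s).
Qed.

(** The lifts of the letters that have fixed points satisfy the relations of A(P4), so they define
    an action on the line that lifts [phi]. *)
Lemma circle_line_lift : exists psi, line_lift phi proj psi.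
Proof.
have [t [L HL]] := circle_letter_lifts.
pose letter v (s : bool) := if s then A_P4_gen v else (A_P4_gen v)^-1%g.
have lL v s : circle_lift (phi (letter v s)) (L v s) by have [] := HL v s.
have Lt v s : L v s (t v) = t v by have [] := HL v s.
have LK v s : cancel (L v (~~ s)) (L v s).
  have e : phi (letter v s) \o phi (letter v (~~ s)) = id.
    by rewrite -phi_hom; case: s; rewrite /letter /= ?mulgV ?mulVg.
  have lc := circle_lift_comp (lL v s) (lL v (~~ s)).
  rewrite e in lc; move=> x.
  have := circle_lift_eq (s := t v) lc (circle_lift_id R).
  by move=> /(_ _)/(congr1 (fun F => F x)) /=; apply; rewrite /= !Lt.
have homoL v s : {homo L v s : x y / x < y} by exact: circle_lift_homo (lL v s).
have posint v s : exists2 k : int, (1 <= k)%R & forall x, L v s (x + 1) = L v s x + k%:~R.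
  have l1 : circle_lift (phi (letter v s)) (fun x => L v s (x + 1)).
    have [cL pL] := lL v s; split=> [x|x].
      have c1 : {for x, continuous (fun x : R => x + 1)}.
        by apply: continuousD; [exact: cvg_id|exact: cst_continuous].
      exact: (continuous_comp c1 (cL (x + 1))).
    by rewrite pL; congr (phi _ _); apply/circle_projP; exists 1.
  have [k hk] := circle_lift_unique l1 (lL v s); exists k => //.
  have : L v s 0 < L v s (0 + 1) by apply: homoL; rewrite add0r.
  by rewrite hk ltrDl ltr0z; lia.
(* If the degree were at least 2, then L x + 1 < L (x + 1); the inverse lift, of degree at least 1,
   sends the left side to x + 1 or beyond and the right side to x + 1. *)
have periodL v s x : L v s (x + 1) = L v s x + 1.
  have [k k1 hk] := posint v s; have [l l1 hl] := posint v (~~ s).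
  have [k2|k2] := leP 2 k; last by rewrite hk; have -> : k = 1 by lia.
  have kR : (2%:~R <= k%:~R :> R) by rewrite ler_int.
  have lR : (1%:~R <= l%:~R :> R) by rewrite ler_int.
  have : L v s x + 1 < L v s (x + 1) by rewrite hk ltrD2l; lra.
  move=> /(homoL v (~~ s)); rewrite hl.
  have LK' y : L v (~~ s) (L v s y) = y by rewrite -{2}(negbK s) LK.
  by rewrite !LK'; lra.
have Lcomm u v x : P4_edge u v -> L u true (L v true x) = L v true (L u true x).
  move=> uv; have luv := circle_lift_comp (lL u true) (lL v true).
  have lvu := circle_lift_comp (lL v true) (lL u true).
  rewrite -phi_hom /letter (P4_commute uv) phi_hom in luv.
  have [k hk] := circle_lift_unique luv lvu.
  (* The two composites differ by k. At the fixed point [t v] of [L v], this k is up to sign the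
     displacement by [L v] of a point, which is less than 1. *)
  have k0 : k = 0.
    apply: (@int_lt1_eq0 R); have := hk (t v); rewrite /= Lt => e.
    have := periodic_homo_near (L u true (t v)) (homoL v true) (periodL v true) (Lt v true).
    by rewrite {2}e opprD addrA subrr sub0r normrN.
  by have := hk x; rewrite /= k0 addr0.
pose psi := raag_act (e := P4_edge) L.
have psi1 x : psi 1%g x = x by exact: raag_act1.
have psiM g h x : psi (g * h)%g x = psi g (psi h x) by exact: raag_actM.
have psigen v : psi (A_P4_gen v) = L v true by apply/funext => x; exact: raag_act_gen.
have psigenV v : psi (A_P4_gen v)^-1%g = L v false by apply/funext => x; exact: raag_act_genV.
have [lpsi ppsi] : (forall g, circle_lift (phi g) (psi g)) /\
    forall g x, psi g (x + 1) = psi g x + 1.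
  suff H g : circle_lift (phi g) (psi g) /\ forall x, psi g (x + 1) = psi g x + 1.
    by split=> g; have [] := H g.
  elim/raag_ind: g => [|g h [lg pg] [lh ph]|v|v].
  - have -> : psi 1%g = id by apply/funext.
    by rewrite phi1; split=> //; exact: circle_lift_id.
  - have -> : psi (g * h)%g = psi g \o psi h by apply/funext => x; exact: psiM.
    rewrite phi_hom; split=> [|x /=]; first exact: circle_lift_comp.
    by rewrite ph pg.
  - by rewrite -/(A_P4_gen v) psigen; split; [exact: (lL v true)|exact: periodL].
  - by rewrite -/(A_P4_gen v) psigenV; split; [exact: (lL v false)|exact: periodL].
have equi g x : proj (psi g x) = phi g (proj x) by case: (lpsi g) => _ ->.
have A : line_action psi.
  by split=> // g x y xy; apply: circle_lift_homo (lpsi g) _ _ xy.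
(* A point of the line over a fixed point is displaced by an integer of absolute value less than 1,
   hence by 0. *)
have moved v x : psi (A_P4_gen v) x <> x -> phi (A_P4_gen v) (proj x) <> proj x.
  move=> vx; rewrite -equi => /circle_projP [k e]; apply: vx; rewrite e.
  suff -> : k = 0 by rewrite addr0.
  apply: (@int_lt1_eq0 R).
  have := periodic_homo_near x (homoL v true) (periodL v true) (Lt v true).
  by rewrite -psigen e addrC addKr.
have fix_int v (k : int) : psi (A_P4_gen v) (t v + k%:~R) = t v + k%:~R.
  by rewrite (periodic_int (ppsi _)) psigen Lt.
exists psi; split=> //.
- move=> g p q [pq gp gq free] k; apply: circle_lift_C1bv (lpsi k) pq _ => //.
  (* A support interval has length at most 1, because p + 1 is fixed along with p. *)
  rewrite leNgt; apply/negP => lt; apply: (free (p + 1)); first by apply/andP; split; lra.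
  by rewrite ppsi gp.
- move=> v x; pose m := Num.floor (x - t v).
  have m1 : m%:~R <= x - t v by exact: floor_le.
  have m2 : x - t v < (m + 1)%:~R by exact: floorD1_gt.
  by split; [exists (t v + m%:~R) => //; lra|exists (t v + (m + 1)%:~R) => //; lra].
- move=> t0; exists t0, (t0 + 1); split=> [|g g0|g g0 gid]; first lra.
    by rewrite ppsi g0.
  apply: phi_inj; rewrite phi1; apply/funext => Y.
  have [y0 <-] := circle_proj_surj Y.
  pose m := Num.floor (y0 - t0); pose y := y0 - m%:~R.
  have m1 : m%:~R <= y0 - t0 by exact: floor_le.
  have m2 : y0 - t0 < m%:~R + 1 by rewrite -intrD1 floorD1_gt.
  have <- : proj y = proj y0 by apply/circle_projP; exists (- m); rewrite mulrNz.
  have ty : t0 <= y <= t0 + 1 by rewrite /y; apply/andP; split; lra.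
  by rewrite -equi gid.
- by move=> v z s x t'; exact: (circle_components_differ equi (@moved v)).
- move=> v z s x t' /mirror_fixN vz /mirror_fixN vx vs vt' zs sx xt tz /= e.
  (* Reflection reverses the order, so the base point becomes the translate -z - 1 of the fixed
     point -z, on the left of -t'. *)
  apply: (@circle_components_differ psi v (- z - 1) (- t') (- x) (- s)) => //.
  + exact: moved.
  + by apply: (addIr 1); rewrite -ppsi subrK vz.
  + by move=> /mirror_fixN.
  + by move=> /mirror_fixN.
  + lra.
  + by rewrite ltrN2.
  + by rewrite ltrN2.
  + lra.
Qed.

End CircleLift.

Theorem proposition1p6 (R : realType) (M : one_manifold)
    (phi : A_P4 -> carrier R M -> carrier R M)
    (phi_Diff : forall g : A_P4, Diff1bv (phi g))
    (phi_hom : forall g h : A_P4, phi (g * h)%g = phi g \o phi h)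
    (phi_inj : injective phi)
    (phi_fix : forall v : P4_vertex, Fix (phi (A_P4_gen v)) !=set0) :
  exists I_a I_d : nat -> set (carrier R M),
    [/\ forall j, pi0 (supp (phi (A_P4_gen va))) (I_a j),
        forall j, pi0 (supp (phi (A_P4_gen vd))) (I_d j),
        forall j k, j <> k -> I_a j <> I_a k,
        forall j k, j <> k -> I_d j <> I_d k &
        forall j, I_a j <> I_d j /\
          (phi (A_P4_gen vc * A_P4_gen vb)%g @` I_a j) `&` I_d j !=set0].
Proof.
case: M phi phi_Diff phi_hom phi_inj phi_fix => phi phi_Diff phi_hom phi_inj phi_fix.
  exact: (line_lift_matching (interval_line_lift phi_Diff phi_hom phi_inj)).
have [psi lift] := circle_line_lift phi_Diff phi_hom phi_inj phi_fix.
exact: (line_lift_matching lift).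
Qed.
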